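(* Let $\mathcal{A}$ be a unital $C^*$-algebra such that $K(\mathcal{A})$ satisfies the cancellation property. If $F \in \tilde{\mathcal{M}}\Phi_+^-(H_{\mathcal{A}})$, then for any decomposition $$H_{\mathcal{A}} = M_1' \tilde\oplus N_1' \stackrel{F}{\longrightarrow} M_2' \tilde\oplus N_2' = H_{\mathcal{A}}$$ with respect to which $F$ has the matrix $\begin{bmatrix} F_1' & 0 \\ 0 & F_4' \end{bmatrix}$, where $F_1': M_1' \to M_2'$ is an isomorphism and $N_1', N_2'$ are finitely generated, we have $N_1' \preceq N_2'$. Similarly, if $F \in \tilde{\mathcal{M}}\Phi_-^+(H_{\mathcal{A}})$, then $N_2' \preceq N_1'$ for any such decomposition.
   Context: $\mathcal{A}$ is a unital $C^*$-algebra; $H_{\mathcal{A}} = \ell^2(\mathcal{A})$ is the standard Hilbert $\mathcal{A}$-module, and $B^a(H_{\mathcal{A}})$ is the $C^*$-algebra of bounded adjointable $\mathcal{A}$-linear operators on it. All submodules in decompositions are closed; $M \tilde\oplus N$ denotes a direct sum of closed submodules that is not necessarily orthogonal. A Hilbert module is finitely generated if it is the (algebraic) $\mathcal{A}$-linear span of a finite set. An isomorphism ($\cong$) of Hilbert modules is a bounded $\mathcal{A}$-linear bijection (with bounded inverse). $N_1 \preceq N_2$ means that $N_1$ is isomorphic to a closed submodule of $N_2$. $F$ having a diagonal matrix with entries $F_1,F_4$ with respect to $M_1 \tilde\oplus N_1 \to M_2 \tilde\oplus N_2$ means $F(M_1)\subseteq M_2$, $F(N_1)\subseteq N_2$, $F_1=F|_{M_1}$,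 $F_4=F|_{N_1}$. $K(\mathcal{A}) = K_0(\mathcal{A})$ is the Grothendieck group of isomorphism classes of finitely generated projective modules (closed finitely generated submodules of $H_{\mathcal{A}}$ are projective). $K(\mathcal{A})$ satisfies the cancellation property if $[N]=[M]$ in $K(\mathcal{A})$ implies $N \cong M$ for any two finitely generated closed submodules $M, N$ of $H_{\mathcal{A}}$. $\tilde{\mathcal{M}}\Phi_+^-(H_{\mathcal{A}})$ is the set of $F \in B^a(H_{\mathcal{A}})$ for which there is a decomposition $H_{\mathcal{A}} = M_1 \tilde\oplus N_1 \to M_2 \tilde\oplus N_2 = H_{\mathcal{A}}$ with respect to which $F$ is diagonal with $F_1$ an isomorphism, $N_1, N_2$ finitely generated, and $N_1 \preceq N_2$. $\tilde{\mathcal{M}}\Phi_-^+(H_{\mathcal{A}})$ is defined in the same way but with $N_2 \preceq N_1$ instead. *)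

(* Defs.v *)
From HB Require Import structures.
From mathcomp Require Import all_boot all_order all_algebra.
From mathcomp Require Import complex.
From mathcomp Require Import boolp classical_sets functions reals topology.
From mathcomp Require Import normedtype sequences.

Set Implicit Arguments.
Unset Strict Implicit.
Unset Printing Implicit Defensive.

Import Order.TTheory GRing.Theory Num.Theory.
Import numFieldNormedType.Exports.

Local Open Scope classical_set_scope.
Local Open Scope ring_scope.
Local Open Scope complex_scope.

(** * Unital C*-algebras *)

(* The norm of a [normedModType] over [R[i]] takes its values in [R[i]], where
   [0 <= z] means that [z] is real and nonnegative.  The product belongs to the
   mixin, and the ring structure is derived from it below, because the
   hierarchy admits no join of its rings with its normed modules.  As [1 = 0]
   is allowed, the scalars are related to the product by [cmulZl] and [cmulZr]
   rather than through [algType]. *)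
HB.mixin Record isUnitalCstar (R : realType) (A : Type)
    of CompleteNormedModule R[i] A := {
  cmul : A -> A -> A;
  cone : A;
  star : A -> A;
  cmulA : associative cmul;
  cmul1l : left_id cone cmul;
  cmul1r : right_id cone cmul;
  cmulDl : left_distributive cmul +%R;
  cmulDr : right_distributive cmul +%R;
  cmulZl : forall (c : R[i]) (a b : A), cmul (c *: a) b = c *: cmul a b;
  cmulZr : forall (c : R[i]) (a b : A), cmul a (c *: b) = c *: cmul a b;
  starK : involutive star;
  starD : {morph star : a b / a + b};
  starZ : forall (c : R[i]) (a : A), star (c *: a) = c^* *: star a;
  starM : forall a b : A, star (cmul a b) = cmul (star b) (star a);
  cmul_norm : forall a b : A, `|cmul a b| <= `|a| * `|b|;
  cstar_norm : forall a : A, `|cmul (star a) a| = `|a| ^+ 2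
}.

#[short(type="unitalCstarType")]
HB.structure Definition UnitalCstar (R : realType) :=
  {A of CompleteNormedModule R[i] A & isUnitalCstar R A}.

HB.instance Definition _ (R : realType) (A : unitalCstarType R) :=
  GRing.Zmodule_isPzRing.Build A cmulA cmul1l cmul1r cmulDl cmulDr.

Section CstarTheory.
Variables (R : realType) (A : unitalCstarType R).
Implicit Types (c : R[i]) (a b : A).

Lemma cstar_scaleAl c a b : c *: (a * b) = c *: a * b.
Proof. by rewrite [RHS]cmulZl. Qed.

Lemma cstar_scaleAr c a b : c *: (a * b) = a * (c *: b).
Proof. by rewrite [RHS]cmulZr. Qed.

Lemma star_mul a b : star (a * b) = star b * star a.
Proof. exact: starM. Qed.

Lemma cstar_norm_mul a b : `|a * b| <= `|a| * `|b|.
Proof. exact: cmul_norm. Qed.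

Lemma cstar_normE a : `|star a * a| = `|a| ^+ 2.
Proof. exact: cstar_norm. Qed.

End CstarTheory.

(** * Finitely generated projective modules and the Grothendieck group *)

(* Right [A]-modules are encoded as left modules over the converse ring [A^c]:
   for [a : A^c], [a *: x] stands for [x a].  Since [A] is unital, [A]-linear
   maps are automatically complex linear. *)

Section Modules.
Variable B : pzRingType.
Implicit Types P Q S : lmodType B.

Definition fin_generated P : Prop :=
  exists (n : nat) (g : 'I_n -> P),
    forall x : P, exists a : 'I_n -> B, x = \sum_i a i *: g i.

Definition projective P : Prop :=
  forall (U V : lmodType B) (p : {linear U -> V}) (f : {linear P -> V}),
    (forall v, exists u, p u = v) ->
    exists h : {linear P -> U}, forall x, p (h x) = f x.

Definition lmod_iso P Q : Prop := exists f : {linear P -> Q}, bijective f.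

Record fgproj := FGProj {
  fgproj_sort :> lmodType B;
  fgproj_fg : fin_generated fgproj_sort;
  fgproj_proj : projective fgproj_sort
}.

Lemma lmod_isoI P Q (f : P -> Q) (g : Q -> P) :
  linear f -> cancel f g -> cancel g f -> lmod_iso P Q.
Proof.
move=> lf fK gK.
pose F : {linear P -> Q} := HB.pack f (GRing.isLinear.Build _ _ _ _ f lf).
by exists F; exists g.
Qed.

Lemma lmod_iso_refl P : lmod_iso P P.
Proof. by exists idfun; exists idfun. Qed.

Lemma lmod_iso_sym P Q : lmod_iso P Q -> lmod_iso Q P.
Proof.
move=> [f [g fK gK]].
apply: (@lmod_isoI _ _ g f) => // a x y.
by apply: (can_inj fK); rewrite linearP !gK.
Qed.

Lemma lmod_iso_trans P Q S : lmod_iso P Q -> lmod_iso Q S -> lmod_iso P S.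
Proof.
by move=> [f bf] [g bg]; exists (g \o f : {linear _ -> _}); apply: bij_comp.
Qed.

Definition dsum P Q : lmodType B := (P * Q)%type.

Lemma lmod_iso_prod P P' Q Q' :
  lmod_iso P P' -> lmod_iso Q Q' -> lmod_iso (dsum P Q) (dsum P' Q').
Proof.
move=> [f [f' fK f'K]] [g [g' gK g'K]].
apply: (@lmod_isoI (dsum P Q) (dsum P' Q')
  (fun x => (f x.1, g x.2)) (fun x => (f' x.1, g' x.2))).
- by move=> a x y; rewrite /= !linearP.
- by case=> x y; rewrite /= fK gK.
- by case=> x y; rewrite /= f'K g'K.
Qed.

Lemma fin_generated0 : fin_generated 'rV[B]_0.
Proof.
exists 0%N, (fun=> 0) => x; exists (fun=> 0).
by rewrite big_ord0 thinmx0.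
Qed.

Lemma projective0 : projective 'rV[B]_0.
Proof.
move=> U V p f _.
have l0 : linear (fun _ : 'rV[B]_0 => 0 : U).
  by move=> a x y; rewrite scaler0 addr0.
pose h : {linear 'rV[B]_0 -> U} :=
  HB.pack (fun _ : 'rV[B]_0 => 0 : U) (GRing.isLinear.Build _ _ _ _ _ l0).
by exists h => x; rewrite [x]thinmx0 !linear0.
Qed.

Definition fgproj0 : fgproj := FGProj fin_generated0 projective0.

Let inj1 P Q (x : P) : dsum P Q := (x, 0).
Let inj2 P Q (y : Q) : dsum P Q := (0, y).

Let inj1_linear P Q : linear (@inj1 P Q).
Proof. by move=> a x y; congr (_, _); rewrite /= scaler0 addr0. Qed.

Let inj2_linear P Q : linear (@inj2 P Q).
Proof. by move=> a x y; congr (_, _); rewrite /= scaler0 addr0. Qed.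

HB.instance Definition _ P Q :=
  GRing.isLinear.Build B P (dsum P Q) _ (@inj1 P Q) (@inj1_linear P Q).
HB.instance Definition _ P Q :=
  GRing.isLinear.Build B Q (dsum P Q) _ (@inj2 P Q) (@inj2_linear P Q).

Let dsumE P Q (x : P) (y : Q) : (x, y) = inj1 Q x + inj2 P y.
Proof. by congr (_, _); rewrite /= ?addr0 ?add0r. Qed.

Lemma fin_generated_prod P Q :
  fin_generated P -> fin_generated Q -> fin_generated (dsum P Q).
Proof.
move=> [n [g gP]] [m [h hQ]].
exists (n + m)%N, (fun i => match fintype.split i with
  | inl j => inj1 Q (g j) | inr j => inj2 P (h j) end).
move=> [x y]; have [a ->] := gP x; have [b ->] := hQ y.
exists (fun i => match fintype.split i with inl j => a j | inr j => b j end).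
rewrite dsumE !linear_sum big_split_ord /=; congr +%R; apply: eq_bigr => i _.
  by rewrite linearZ (unsplitK (inl i : 'I_n + 'I_m)).
by rewrite linearZ (unsplitK (inr i : 'I_n + 'I_m)).
Qed.

Lemma projective_prod P Q :
  projective P -> projective Q -> projective (dsum P Q).
Proof.
move=> pP pQ U V p f ps.
have [h1 h1E] := pP U V p (f \o @inj1 P Q : {linear _ -> _}) ps.
have [h2 h2E] := pQ U V p (f \o @inj2 P Q : {linear _ -> _}) ps.
pose h (x : dsum P Q) : U := h1 x.1 + h2 x.2.
have lh : linear h.
  by move=> a [? ?] [? ?]; rewrite /h /= !linearP /= scalerDr addrACA.
pose H : {linear dsum P Q -> U} := HB.pack h (GRing.isLinear.Build _ _ _ _ h lh).
by exists H => -[x y]; rewrite /= /h linearD /= h1E h2E dsumE linearD.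
Qed.

Definition fgproj_sum (P Q : fgproj) : fgproj :=
  FGProj (fin_generated_prod (@fgproj_fg P) (@fgproj_fg Q))
         (projective_prod (@fgproj_proj P) (@fgproj_proj Q)).

(* A pair [(P, Q)] stands for the formal difference [[P] - [Q]]. *)
Definition K0_equiv (p q : fgproj * fgproj) : Prop :=
  exists S : fgproj, lmod_iso (dsum (dsum p.1 q.2) S) (dsum (dsum q.1 p.2) S).

Lemma K0_equiv_refl p : K0_equiv p p.
Proof. by exists fgproj0; apply: lmod_iso_refl. Qed.

Lemma K0_equiv_sym p q : K0_equiv p q -> K0_equiv q p.
Proof. by move=> [S pq]; exists S; apply: lmod_iso_sym. Qed.

Lemma K0_equiv_trans p q r : K0_equiv p q -> K0_equiv q r -> K0_equiv p r.
Proof.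
move=> [S pq] [T qr].
exists (fgproj_sum (fgproj_sum q.2 S) (fgproj_sum q.1 T)) => /=.
have shuffle1 a b c d (s t : lmodType B) :
    lmod_iso (dsum (dsum a b) (dsum (dsum c s) (dsum d t)))
             (dsum (dsum (dsum a c) s) (dsum (dsum d b) t)).
  apply: (@lmod_isoI (dsum (dsum a b) (dsum (dsum c s) (dsum d t)))
                     (dsum (dsum (dsum a c) s) (dsum (dsum d b) t))
    (fun x => (x.1.1, x.2.1.1, x.2.1.2, (x.2.2.1, x.1.2, x.2.2.2)))
    (fun x => (x.1.1.1, x.2.1.2, (x.1.1.2, x.1.2, (x.2.1.1, x.2.2))))) => //.
    by move=> [[? ?] [[? ?] [? ?]]].
  by move=> [[[? ?] ?] [[? ?] ?]].
have shuffle2 a b c d (s t : lmodType B) :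
    lmod_iso (dsum (dsum (dsum d b) s) (dsum (dsum a c) t))
             (dsum (dsum a b) (dsum (dsum c s) (dsum d t))).
  apply: (@lmod_isoI (dsum (dsum (dsum d b) s) (dsum (dsum a c) t))
                     (dsum (dsum a b) (dsum (dsum c s) (dsum d t)))
    (fun x => (x.2.1.1, x.1.1.2, (x.2.1.2, x.1.2, (x.1.1.1, x.2.2))))
    (fun x => (x.2.2.1, x.1.2, x.2.1.2, (x.1.1, x.2.1.1, x.2.2.2)))) => //.
    by move=> [[[? ?] ?] [[? ?] ?]].
  by move=> [[? ?] [[? ?] [? ?]]].
apply: lmod_iso_trans (shuffle1 _ _ _ _ _ _) _.
exact: lmod_iso_trans (lmod_iso_prod pq qr) (shuffle2 _ _ _ _ _ _).
Qed.

(* The underlying set of the Grothendieck group.  Its elements are the classes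
   of formal differences, as predicates; [fgproj] is too large a type for the
   library's quotients and algebraic structures, which live in a fixed
   universe. *)
Definition K0 := {c : fgproj * fgproj -> Prop | exists p, c = K0_equiv p}.

Definition K0_mk (p : fgproj * fgproj) : K0 :=
  exist _ (K0_equiv p) (ex_intro _ p erefl).

Lemma K0_mkE p q : K0_mk p = K0_mk q <-> K0_equiv p q.
Proof.
split=> [/(congr1 sval)/= ->|pq]; first exact: K0_equiv_refl.
apply: eq_exist => /=; apply/funext => r; apply/propext; split.
  exact/K0_equiv_trans/K0_equiv_sym.
exact: K0_equiv_trans.
Qed.

Definition K0_class (P : fgproj) : K0 := K0_mk (P, fgproj0).

Lemma K0_classE (P Q : fgproj) : K0_class P = K0_class Q <->
  exists S : fgproj, lmod_iso (dsum P S) (dsum Q S).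
Proof.
have dsum0 (M : lmodType B) : lmod_iso (dsum M 'rV[B]_0) M.
  exists (@fst _ _ : {linear dsum M 'rV[B]_0 -> M}), (fun x => (x, 0)) => //.
  by move=> [x y]; rewrite [y]thinmx0.
rewrite K0_mkE; split=> -[S PQ]; exists S.
  apply: lmod_iso_trans (lmod_iso_trans PQ _) => /=.
    exact/lmod_iso_sym/lmod_iso_prod/lmod_iso_refl/dsum0.
  exact/lmod_iso_prod/lmod_iso_refl/dsum0.
apply: lmod_iso_trans (lmod_iso_trans PQ _) => /=.
  exact/lmod_iso_prod/lmod_iso_refl/dsum0.
exact/lmod_iso_sym/lmod_iso_prod/lmod_iso_refl/dsum0.
Qed.

End Modules.

(** * The standard Hilbert module and its closed submodules *)

Definition sequ (R : realType) (A : unitalCstarType R) : Type := nat -> A.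

Section Sequ.
Variables (R : realType) (A : unitalCstarType R).

HB.instance Definition _ := GRing.Zmodule.copy (sequ A) (nat -> A).

Let rscale (a : A^c) (x : sequ A) : sequ A := fun i => x i * (a : A).

Let rscaleA a b x : rscale a (rscale b x) = rscale (a * b) x.
Proof. by apply/funext => i; rewrite /rscale -mulrA. Qed.

Let rscale1 : left_id 1 rscale.
Proof. by move=> x; apply/funext => i; rewrite /rscale mulr1. Qed.

Let rscaleDr : right_distributive rscale +%R.
Proof. by move=> a x y; apply/funext => i; rewrite /rscale mulrDl. Qed.

Let rscaleDl x : {morph rscale^~ x : a b / a + b}.
Proof. by move=> a b; apply/funext => i; rewrite /rscale mulrDr. Qed.

HB.instance Definition _ := GRing.Zmodule_isLmodule.Build A^c (sequ A)
  rscaleA rscale1 rscaleDr rscaleDl.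

End Sequ.

Section HilbertModule.
Variables (R : realType) (A : unitalCstarType R).
Implicit Types x y : sequ A.

(* The underlying set of [H_A]. *)
Definition ell2 : set (sequ A) :=
  [set x | cvgn (series (fun i => star (x i) * x i))].

(* The inner product is conjugate-linear in its first argument, and is
   meaningful for [x] and [y] in [ell2]. *)
Definition inner x y : A := limn (series (fun i => star (x i) * y i)).

Definition hnorm x : R[i] := sqrtC `|inner x x|.

Record closed_submodule := ClosedSubmodule {
  cs_set : set (sequ A);
  cs_sub : cs_set `<=` ell2;
  cs_zero : cs_set 0;
  cs_lin : forall (a : A^c) x y, cs_set x -> cs_set y -> cs_set (a *: x + y);
  cs_closed : forall x, ell2 x ->
    (forall e : R[i], 0 < e -> exists2 y, cs_set y & hnorm (x - y) < e) ->
    cs_set x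
}.

Definition cs_pred (M : closed_submodule) : {pred sequ A} :=
  fun x => `[< cs_set M x >].

Lemma cs_submod_closed M : submod_closed (cs_pred M).
Proof.
split=> [|a x y]; first exact/asboolP/cs_zero.
by move=> /asboolP Mx /asboolP My; apply/asboolP/cs_lin.
Qed.

HB.instance Definition _ M :=
  GRing.isSubmodClosed.Build A^c (sequ A) (cs_pred M) (cs_submod_closed M).

Record cs_type (M : closed_submodule) :=
  CsType { cs_val :> sequ A; cs_valP : cs_val \in cs_pred M }.

HB.instance Definition _ M := [isSub for @cs_val M].
HB.instance Definition _ M := [Choice of cs_type M by <:].
HB.instance Definition _ M :=
  [SubChoice_isSubLmodule of cs_type M by <:].

Definition bounded_map (M N : closed_submodule) (f : cs_type M -> cs_type N) :
    Prop :=
  exists k : R[i], forall x : cs_type M, hnorm (f x) <= k * hnorm x.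

Definition is_hiso (M N : closed_submodule)
    (f : {linear cs_type M -> cs_type N}) : Prop :=
  bounded_map f /\ exists g : {linear cs_type N -> cs_type M},
    [/\ cancel f g, cancel g f & bounded_map g].

Definition hiso (M N : closed_submodule) : Prop :=
  exists f : {linear cs_type M -> cs_type N}, is_hiso f.

Definition prec (M N : closed_submodule) : Prop :=
  exists2 P : closed_submodule, cs_set P `<=` cs_set N & hiso M P.

Definition cs_fg (M : closed_submodule) : Prop := fin_generated (cs_type M).

Definition direct_sum (M N : closed_submodule) : Prop :=
  (forall x, ell2 x -> exists y z, [/\ cs_set M y, cs_set N z & x = y + z]) /\
  (forall x, cs_set M x -> cs_set N x -> x = 0).

(* Finitely generated closed submodules of [H_A] are always projective; the
   proofs of projectivity are only there to form the classes. *)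
Definition K0_cancellation : Prop :=
  forall (M N : closed_submodule) (fM : cs_fg M) (fN : cs_fg N)
    (pM : projective (cs_type M)) (pN : projective (cs_type N)),
    K0_class (FGProj fN pN) = K0_class (FGProj fM pM) -> hiso N M.

(** * Operators *)

(* Operators on [H_A] are maps of sequences of which only the restriction to
   [ell2] matters. *)
Definition adjointable (F : sequ A -> sequ A) : Prop :=
  [/\ forall x, ell2 x -> ell2 (F x),
      forall (a : A^c) x y, ell2 x -> ell2 y -> F (a *: x + y) = a *: F x + F y,
      exists k : R[i], forall x, ell2 x -> hnorm (F x) <= k * hnorm x
    & exists G : sequ A -> sequ A,
        (forall x, ell2 x -> ell2 (G x)) /\
        (forall x y, ell2 x -> ell2 y -> inner (F x) y = inner x (G y))].

Definition fredholm_decomposition (F : sequ A -> sequ A)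
    (M1 N1 M2 N2 : closed_submodule) : Prop :=
  [/\ direct_sum M1 N1 /\ direct_sum M2 N2,
      exists f : {linear cs_type M1 -> cs_type M2},
        is_hiso f /\ (forall x : cs_type M1, f x = F x :> sequ A),
      forall x, cs_set N1 x -> cs_set N2 (F x)
    & cs_fg N1 /\ cs_fg N2].

Definition MPhi_plus_minus (F : sequ A -> sequ A) : Prop :=
  adjointable F /\
  exists M1 N1 M2 N2, fredholm_decomposition F M1 N1 M2 N2 /\ prec N1 N2.

Definition MPhi_minus_plus (F : sequ A -> sequ A) : Prop :=
  adjointable F /\
  exists M1 N1 M2 N2, fredholm_decomposition F M1 N1 M2 N2 /\ prec N2 N1.

End HilbertModule.

Arguments K0_cancellation {R} A.

(* Main.v *)
(* A diagonal decomposition of [F], with an isomorphism [M1 -> M2], makes the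
   complex [N1 -> N2] homotopy equivalent to [F : H_A -> H_A].  The complexes of
   two decompositions are thus homotopy equivalent, and the mapping cone of the
   equivalence splits as an isomorphism of [N1 + N2'] with [N2 + N1'].  If
   [N2 = P + Q] with [P] a copy of [N1], then [N2'] and [N1' + Q] have the same
   class in [K_0], so by cancellation [N1'] embeds in [N2'].

   The analytic input is that a finitely generated closed submodule [P] of [H_A]
   is projective and complemented.  With generators [p i], the operator
   [S x = \sum_i p_i <p_i, x>] is bounded below on [P], by a gliding hump
   argument, and then bijective on [P], by continuity along [t + S], [t >= 0].
   The Cauchy-Schwarz inequality and the monotonicity of the norm on positive
   elements rest on the positivity of [star a * a]. *)

From HB Require Import structures.
From mathcomp Require Import all_boot all_order all_algebra.
From mathcomp Require Import complex lra ring.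
From mathcomp Require Import boolp classical_sets functions reals topology.
From mathcomp Require Import normedtype sequences.
Require Import Defs.

Set Implicit Arguments.
Unset Strict Implicit.
Unset Printing Implicit Defensive.

Import Order.TTheory GRing.Theory Num.Theory.
Import numFieldNormedType.Exports.

Local Open Scope classical_set_scope.
Local Open Scope ring_scope.
Local Open Scope complex_scope.

(** * The real-valued norm *)

Section RealNorm.
Variables (R : realType) (A : unitalCstarType R).
Implicit Types (a b h k : A) (t : R).

(** The modules of two decompositions have no common position in [H_A], so complexes are compared
    instead of subspaces. The outcome is an algebraic isomorphism that carries no bound. Boundedness
    returns through cancellation, whose conclusion is an isomorphism of Hilbert modules; as it
    speaks of submodules of [H_A] only, the external sum of [N1'] and [Q] has to be realized there.
    The summand that witnesses equality in [K_0] is [N1] itself: [N2' + N1] is isomorphic to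
    [N2 + N1'], that is to [N1 + Q + N1'].

    On the analytic side, [pos h] means that [h] is the square of a selfadjoint element. For a
    selfadjoint [h] of norm at most 1 this amounts to [nrm (1 - h) <= 1], a convex condition that
    stands in for the location of the spectrum. Square roots are limits of an iteration and commute
    with whatever commutes with [h]; this is what allows them to be multiplied and paired into
    unitaries. *)

Definition nrm a : R := complex.Re `|a|.

Lemma normE a : `|a| = (nrm a)%:C.
Proof. by rewrite /nrm RRe_real ?normr_real. Qed.

Lemma nrm_ge0 a : 0 <= nrm a.
Proof. by rewrite -ler0c -normE. Qed.

Lemma nrm0 : nrm 0 = 0.
Proof. by rewrite /nrm normr0. Qed.

Lemma nrm_eq0 a : nrm a = 0 -> a = 0.
Proof. by move=> a0; apply/normr0_eq0; rewrite normE a0. Qed.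

Lemma nrm_gt0 a : a <> 0 -> 0 < nrm a.
Proof.
by move=> a0; rewrite lt_neqAle nrm_ge0 andbT eq_sym; apply/eqP => /nrm_eq0.
Qed.

Lemma nrmN a : nrm (- a) = nrm a.
Proof. by rewrite /nrm normrN. Qed.

Lemma nrmBC a b : nrm (a - b) = nrm (b - a).
Proof. by rewrite -nrmN opprB. Qed.

Lemma nrmD a b : nrm (a + b) <= nrm a + nrm b.
Proof. by rewrite -lecR rmorphD /= -!normE ler_normD. Qed.

Lemma nrmB a b : nrm (a - b) <= nrm a + nrm b.
Proof. by rewrite -(nrmN b) nrmD. Qed.

Lemma nrmDB a b c : nrm (a - c) <= nrm (a - b) + nrm (b - c).
Proof. by rewrite -(subrKA b a) nrmD. Qed.

Lemma nrm_sum n (f : 'I_n -> A) : nrm (\sum_i f i) <= \sum_i nrm (f i).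
Proof.
apply: (big_ind2 (fun a t => nrm a <= t)) => [|a t b u at_ bu|//].
  by rewrite nrm0.
exact: le_trans (nrmD _ _) (lerD at_ bu).
Qed.

Lemma nrmZ t a : nrm (t%:C *: a) = `|t| * nrm a.
Proof.
apply: (@complexI R); rewrite rmorphM /= -!normE normrZ; congr (_ * _).
by rewrite normc_def /= expr0n addr0 sqrtr_sqr.
Qed.

Lemma nrmM a b : nrm (a * b) <= nrm a * nrm b.
Proof. by rewrite -lecR rmorphM /= -!normE cstar_norm_mul. Qed.

Lemma nrm_starM a : nrm (star a * a) = nrm a ^+ 2.
Proof. by apply: (@complexI R); rewrite rmorphXn /= -!normE cstar_normE. Qed.

Lemma star_add a b : star (a + b) = star a + star b.
Proof. exact: starD. Qed.

Lemma star0 : star 0 = 0 :> A.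
Proof. by apply: (addrI (star 0)); rewrite -star_add !addr0. Qed.

Lemma star_opp a : star (- a) = - star a.
Proof. by apply: (addrI (star a)); rewrite -star_add !subrr star0. Qed.

Lemma star_sub a b : star (a - b) = star a - star b.
Proof. by rewrite star_add star_opp. Qed.

Lemma star1 : star 1 = 1 :> A.
Proof. by rewrite -[LHS]mul1r -{1}(starK 1) -star_mul mul1r starK. Qed.

Lemma star_scale t a : star (t%:C *: a) = t%:C *: star a.
Proof. by rewrite starZ conj_Creal// complex_real. Qed.

Lemma star_sum I (r : seq I) (P : pred I) (f : I -> A) :
  star (\sum_(i <- r | P i) f i) = \sum_(i <- r | P i) star (f i).
Proof. exact: (big_morph _ star_add star0). Qed.

(** The C*-identity bounds [nrm b ^+ 2] by [nrm (star b) * nrm b]; cancelling [nrm b] and applying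
    the result to [star a] gives both inequalities. *)
Lemma nrm_star a : nrm (star a) = nrm a.
Proof.
suff le b : nrm b <= nrm (star b).
  by apply/eqP; rewrite eq_le le andbT -{2}(starK a) le.
have := nrmM (star b) b; rewrite nrm_starM expr2.
have [->|/eqP b0] := eqVneq b 0; first by rewrite nrm0 nrm_ge0.
by rewrite ler_pM2r// nrm_gt0.
Qed.

(** [nrm 1] equals its own square, so it is 0 or 1; the value 0 occurs in the trivial algebra,
    whence an inequality. *)
Lemma nrm1_le1 : nrm (1 : A) <= 1.
Proof.
have := nrm_starM 1; rewrite star1 mulr1 => /esym/eqP.
rewrite expr2 -subr_eq0 -{3}(mulr1 (nrm 1)) -mulrBr mulf_eq0.
by case/orP=> [/eqP->//|]; rewrite subr_eq0 => /eqP->.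
Qed.

Lemma scaleRA t u a : t%:C *: (u%:C *: a) = (t * u)%:C *: a.
Proof. by rewrite scalerA -rmorphM. Qed.

Lemma scaleRD t u a : (t + u)%:C *: a = t%:C *: a + u%:C *: a.
Proof. by rewrite rmorphD scalerDl. Qed.

Lemma scaleR1 a : 1%:C *: a = a.
Proof. exact: scale1r. Qed.

(** Convergence in terms of the real-valued norm, so that estimates take place in [R], where [lra]
    and [nra] apply, rather than in [R[i]]. *)
Definition tends (u : nat -> A) a :=
  forall e : R, 0 < e -> \forall n \near \oo, nrm (u n - a) < e.

Lemma tendsP u a : u @ \oo --> a <-> tends u a.
Proof.
split=> [/cvgrPdist_lt ua e e0|ua].
  have := ua e%:C; rewrite ltcR => /(_ e0).
  by apply: filterS => n; rewrite normE ltcR nrmBC.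
apply/cvgrPdist_lt => e e0.
have er : e = (complex.Re e)%:C by rewrite RRe_real ?gtr0_real.
move: e0; rewrite er ltcR => /ua.
by apply: filterS => n; rewrite normE ltcR nrmBC.
Qed.

Lemma tends_unique u a b : tends u a -> tends u b -> a = b.
Proof. by move=> /tendsP ua /tendsP ub; exact: cvg_unique ua ub. Qed.

Lemma tends_complete (u : nat -> A) :
  (forall e : R, 0 < e -> exists N, forall m n, (N <= m)%N -> (m <= n)%N ->
     nrm (u n - u m) < e) -> exists a, tends u a.
Proof.
move=> uC.
suff : cvg (u @ \oo) by move=> cu; exists (lim (u @ \oo)); apply/tendsP.
apply/cauchy_cvgP/cauchy_ballP => e e0.
have er : e = (complex.Re e)%:C by rewrite RRe_real ?gtr0_real.
move: (e0); rewrite er ltcR => /uC[N uN].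
exists (u @` [set n | (N <= n)%N], u @` [set n | (N <= n)%N]).
  by split; exists N => // n Nn; exists n.
move=> [_ _] [/= [m Nm <-] [n Nn <-]]; rewrite -ball_normE /ball_ /= normE ltcR.
case: (leqP m n) => mn; first by rewrite nrmBC uN.
by rewrite uN// ltnW.
Qed.

Lemma tends_cst a : tends (fun=> a) a.
Proof. by move=> e e0; apply: nearW => n; rewrite subrr nrm0. Qed.

Lemma tends_le (u v : nat -> A) a b C : tends u a ->
  (forall n, nrm (v n - b) <= C * nrm (u n - a)) -> tends v b.
Proof.
move=> ua uv e e0.
(* The sign of [C] is unknown, so a positive upper bound of it takes its place. *)
have C0 : 0 < `|C| + 1 by rewrite ltr_wpDl.
near=> n; apply: le_lt_trans (uv n) _.
have : nrm (u n - a) < e / (`|C| + 1).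
    by near: n; apply: ua; rewrite divr_gt0.
rewrite ltr_pdivlMr// => un; apply: le_lt_trans un.
rewrite mulrC ler_wpM2l ?nrm_ge0//.
by rewrite (le_trans (ler_norm _))// lerDl.
Unshelve. all: by end_near. Qed.

Lemma tendsD u v a b : tends u a -> tends v b ->
  tends (fun n => u n + v n) (a + b).
Proof. by move=> /tendsP ua /tendsP vb; apply/tendsP; exact: cvgD ua vb. Qed.

Lemma tendsZ (c : R[i]) u a : tends u a -> tends (fun n => c *: u n) (c *: a).
Proof. by move=> /tendsP ua; apply/tendsP; exact: cvgZl_tmp ua. Qed.

Lemma tends_star u a : tends u a -> tends (fun n => star (u n)) (star a).
Proof.
by move=> ua; apply: (@tends_le _ _ _ _ 1 ua) => n; rewrite -star_sub nrm_star mul1r.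
Qed.

Lemma tendsMl b u a : tends u a -> tends (fun n => b * u n) (b * a).
Proof.
by move=> ua; apply: (@tends_le _ _ _ _ (nrm b) ua) => n; rewrite -mulrBr nrmM.
Qed.

Lemma tendsMr b u a : tends u a -> tends (fun n => u n * b) (a * b).
Proof.
move=> ua; apply: (@tends_le _ _ _ _ (nrm b) ua) => n.
by rewrite -mulrBl mulrC nrmM.
Qed.

Lemma tends_shift u a : tends u a -> tends (fun n => u n.+1) a.
Proof. by move=> /tendsP ua; apply/tendsP; rewrite cvg_shiftS. Qed.

Lemma tends_nrm_le u a t : tends u a ->
  (\forall n \near \oo, nrm (u n) <= t) -> nrm a <= t.
Proof.
move=> ua ut; apply/ler_addgt0Pl => e e0; near \oo => n.
have -> : a = (a - u n) + u n by rewrite subrK.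
apply: le_trans (nrmD _ _) _; apply: lerD; last by near: n.
by rewrite nrmBC ltW//; near: n; exact: ua.
Unshelve. all: by end_near. Qed.

Lemma tends_nrm_ge u a t : tends u a ->
  (\forall n \near \oo, t <= nrm (u n)) -> t <= nrm a.
Proof.
move=> ua ut; apply/ler_addgt0Pl => e e0; near \oo => n.
have tu : t <= nrm (u n) by near: n.
apply: le_trans tu _; rewrite -[u n](subrK a).
apply: le_trans (nrmD _ _) _; apply: lerD => //.
by rewrite ltW//; near: n; exact: ua.
Unshelve. all: by end_near. Qed.

End RealNorm.

(** * Positive elements *)

Section Positivity.
Variables (R : realType) (A : unitalCstarType R).
Implicit Types (a b h k p q : A) (t : R).

Definition sa a := star a = a.

Lemma sa1B a : sa a -> sa (1 - a).
Proof. by rewrite /sa star_sub star1 => ->. Qed.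

Lemma saM a b : sa a -> sa b -> a * b = b * a -> sa (a * b).
Proof. by rewrite /sa star_mul => -> -> ->. Qed.

Lemma saZ t a : sa a -> sa (t%:C *: a).
Proof. by rewrite /sa star_scale => ->. Qed.

Lemma saD a b : sa a -> sa b -> sa (a + b).
Proof. by rewrite /sa star_add => -> ->. Qed.

Lemma saB a b : sa a -> sa b -> sa (a - b).
Proof. by rewrite /sa star_sub => -> ->. Qed.

Lemma nrm_sqr a : sa a -> nrm (a * a) = nrm a ^+ 2.
Proof. by move=> aS; rewrite -nrm_starM aS. Qed.

Lemma comm_1B a b : a * b = b * a -> a * (1 - b) = (1 - b) * a.
Proof. by move=> ab; rewrite mulrBr mulrBl mulr1 mul1r ab. Qed.

Lemma half_double a : 2^-1%:C *: (a + a) = a.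
Proof.
rewrite -{1 2}(scaleR1 a) -scaleRD scaleRA.
by have -> : 2^-1 * (1 + 1) = 1 :> R; [lra|rewrite scaleR1].
Qed.

(* The iterates are dominated by those of the scalar equation
   [2 s = 1 + s ^+ 2], which increase to [1]. *)
Lemma sqrt_iter z : sa z -> nrm z <= 1 -> exists y,
  [/\ sa y, y + y = z + y * y, nrm y <= 1 &
      forall b, b * z = z * b -> b * y = y * b].
Proof.
move=> zS z1.
(* The limit solves [y = (z + y ^+ 2) / 2], which makes [1 - y] a square root of [1 - z]. *)
pose fix y n := if n is m.+1 then 2^-1%:C *: (z + y m * y m) else 0 : A.
pose fix s n : R := if n is m.+1 then 2^-1 * (1 + s m * s m) else 0.
have s0 n : 0 <= s n by case: n => //= n; nra.
have s1 n : s n <= 1 by elim: n => //= n; have := s0 n; nra.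
have ss n : s n <= s n.+1.
  by have := sqr_ge0 (s n - 1); rewrite /= expr2; lra.
have smono m n : (m <= n)%N -> s m <= s n.
  by apply: (@homo_leq _ s <=%R) => //; exact: le_trans.
have ys n : nrm (y n) <= s n.
  elim: n => [|n IH] /=; first by rewrite nrm0.
  rewrite nrmZ ger0_norm ?invr_ge0// ler_wpM2l ?invr_ge0//.
  apply: le_trans (nrmD _ _) _; apply: lerD => //.
  by apply: le_trans (nrmM _ _) _; apply: ler_pM => //; exact: nrm_ge0.
have yd n : nrm (y n.+1 - y n) <= s n.+1 - s n.
  elim: n => [|n IH].
    rewrite /= !mulr0 !addr0 subr0 nrmZ ger0_norm ?invr_ge0// subr0.
    by rewrite ler_wpM2l ?invr_ge0.
  (* This form of the difference of two squares holds without commutation of the iterates. *)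
  have -> : y n.+2 - y n.+1 =
      2^-1%:C *: (y n.+1 * (y n.+1 - y n) + (y n.+1 - y n) * y n).
    rewrite mulrBr mulrBl addrA subrK [RHS]scalerBr /=.
    by rewrite !(scalerDr _ z) opprD addrACA subrr add0r.
  rewrite nrmZ ger0_norm ?invr_ge0//.
  have -> : s n.+2 - s n.+1 =
      2^-1 * (s n.+1 * (s n.+1 - s n) + (s n.+1 - s n) * s n) by rewrite /=; lra.
  rewrite ler_wpM2l ?invr_ge0//; apply: le_trans (nrmD _ _) _.
  apply: lerD; apply: le_trans (nrmM _ _) _; apply: ler_pM => //; exact: nrm_ge0.
have ydd m n : (m <= n)%N -> nrm (y n - y m) <= s n - s m.
  move=> /subnKC <-; elim: (n - m)%N => [|d IH].
    by rewrite addn0 !subrr nrm0.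
  rewrite addnS; apply: le_trans (nrmDB _ (y (m + d)%N) _) _.
  by have := yd (m + d)%N; move: IH; lra.
have sI : nondecreasing_seq s by move=> m n; exact: smono.
have cs : cvgn s by apply: nondecreasing_is_cvgn => //; exists 1 => _ [n _ <-].
have [w yw] : exists w, tends y w.
  apply: tends_complete => d d0.
  have /cvgrPdist_lt/(_ d d0)[N _ sN] := cs.
  exists N => m n Nm mn; apply: le_lt_trans (ydd _ _ mn) _.
  have := sN m Nm; rewrite /= ltr_distl => /andP[_ +].
  by have := nondecreasing_cvgn_le sI cs n; lra.
have yS n : sa (y n).
  by elim: n => [|n IH]; [exact: star0|apply/saZ/saD => //; exact: saM].
exists w; split.
- by apply: (tends_unique _ yw); have := tends_star yw; under eq_fun do rewrite yS.
- have yy : tends (fun n => y n * y n) (w * w).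
    apply: (@tends_le _ _ _ _ _ _ 2 yw) => n.
    rewrite -(subrKA (y n * w)) -mulrBr -mulrBl.
    apply: le_trans (nrmD _ _) _.
    rewrite [leRHS](_ : _ = nrm (y n - w) + nrm (y n - w)); last by lra.
    apply: lerD; apply: le_trans (nrmM _ _) _.
      by apply: ler_piMl; [exact: nrm_ge0|exact: le_trans (ys n) _].
    apply: ler_piMr; first exact: nrm_ge0.
    apply: tends_nrm_le yw _; apply: nearW => {}n.
    exact: le_trans (ys n) _.
  have ww : w = 2^-1%:C *: (z + w * w).
    apply: tends_unique (tends_shift yw) _ => /=.
    by apply/tendsZ/tendsD => //; exact: tends_cst.
  by rewrite {1 2}ww -scalerDr half_double.
- by apply: tends_nrm_le yw _; apply: nearW => n; exact: le_trans (ys n) _.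
- move=> b bz; have bw := tendsMl b yw; apply: tends_unique bw _.
  have yb n : b * y n = y n * b.
    elim: n => [|n IH]; first by rewrite mulr0 mul0r.
    rewrite /= -cstar_scaleAr -cstar_scaleAl mulrDr mulrDl bz.
    by rewrite mulrA IH -mulrA IH mulrA.
  by under eq_fun do rewrite yb; exact: tendsMr.
Qed.

(** For [z = 1 - h] and [2 y = z + y ^+ 2], the element [k = 1 - y] satisfies
    [k ^+ 2 = 1 - 2 y + y ^+ 2 = 1 - z = h]. The commutation clause plays the part of the functional
    calculus. *)
Lemma cstar_sqrt h : sa h -> nrm (1 - h) <= 1 -> exists k,
  [/\ sa k, k * k = h, nrm (1 - k) <= 1 &
      forall b, b * h = h * b -> b * k = k * b].
Proof.
move=> hS h1; have [y [yS yE y1 yC]] := sqrt_iter (sa1B hS) h1.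
exists (1 - y); split.
- exact: sa1B.
- have yyE : y * y = y + y - (1 - h) by rewrite yE addrAC subrr add0r.
  rewrite mulrBl mul1r mulrBr mulr1 opprB yyE (addrAC _ _ (- y)) addrK.
  by rewrite addrA subrK subKr.
- by rewrite subKr.
- move=> b bh; rewrite mulrBl mulrBr mul1r mulr1 yC//.
  by rewrite mulrBl mulrBr mul1r mulr1 bh.
Qed.

(** That every [star x * x] is positive in this sense is the substantial result [pos_starM]. *)
Definition pos h := exists2 k, sa k & k * k = h.

Lemma pos_sa h : pos h -> sa h.
Proof. by move=> [k kS <-]; exact: saM. Qed.

Lemma pos_sqr k : sa k -> pos (k * k).
Proof. by exists k. Qed.

Lemma pos_ball h : sa h -> nrm (1 - h) <= 1 -> pos h.
Proof. by move=> hS /(cstar_sqrt hS)[k [kS kh _ _]]; exists k. Qed.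

(* [a + 'i *: b] is unitary. *)
Lemma nrm_unitary_part a b : sa a -> sa b -> a * b = b * a ->
  a * a + b * b = 1 -> nrm a <= 1.
Proof.
move=> aS bS ab ab1; pose u := a + 'i%R *: b.
have uS : star u = a - 'i%R *: b by rewrite star_add starZ conjCi scaleNr aS bS.
have u1 : nrm u <= 1.
  have := nrm_starM u.
  have -> : star u * u = 1.
    rewrite uS mulrDr !mulrBl -ab1 -!cstar_scaleAl -!cstar_scaleAr ab.
    rewrite scalerA -(expr2 'i%R) sqrCi scaleN1r opprK.
    by rewrite addrA subrK.
  by have := nrm1_le1 A; have := nrm_ge0 u; nra.
have -> : a = 2^-1%:C *: (u + star u).
  by rewrite uS addrACA subrr addr0 half_double.
rewrite nrmZ ger0_norm ?invr_ge0//.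
by have := nrmD u (star u); rewrite nrm_star; lra.
Qed.

(** If [h = k ^+ 2], a square root [s] of [1 - h] commutes with [k], and [s], [k] are the real and
    imaginary parts of a unitary. Hence [nrm s <= 1], and [nrm (1 - h) = nrm s ^+ 2]. *)
Lemma pos_nrm_1B h : pos h -> nrm h <= 1 -> nrm (1 - h) <= 1.
Proof.
move=> [k kS kh] h1; have hS : sa h by rewrite -kh; exact: saM.
have [|s [sS sh _ sC]] := cstar_sqrt (sa1B hS); first by rewrite subKr.
have ks : s * k = k * s.
  by apply/esym/sC; rewrite mulrBr mulrBl mul1r mulr1 -kh mulrA.
have := nrm_unitary_part sS kS ks; rewrite sh kh subrK => /(_ erefl) s1.
by rewrite -sh nrm_sqr//; have := nrm_ge0 s; nra.
Qed.

Lemma posZ t h : 0 <= t -> pos h -> pos (t%:C *: h).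
Proof.
move=> t0 [k kS <-]; exists ((Num.sqrt t)%:C *: k); first exact: saZ.
by rewrite -cstar_scaleAl -cstar_scaleAr scaleRA -expr2 sqr_sqrtr.
Qed.

Lemma pos_scale t h : 0 < t -> pos (t%:C *: h) -> pos h.
Proof.
move=> t0 th; rewrite -(scaleR1 h) -(mulVf (lt0r_neq0 t0)) -scaleRA.
by apply: posZ th; rewrite invr_ge0 ltW.
Qed.

Lemma pos0 : pos 0.
Proof. by exists 0; [exact: star0|rewrite mulr0]. Qed.

Lemma nrm_scale_le1 t a : 0 < t -> nrm a <= t -> nrm (t^-1%:C *: a) <= 1.
Proof.
move=> t0 at_; rewrite nrmZ gtr0_norm ?invr_gt0//.
by rewrite ler_pdivrMl// mulr1.
Qed.

(** Scaled by the inverse of [t], both summands satisfy the convex condition [nrm (1 - h) <= 1],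
    hence so does their midpoint, and this condition implies positivity. *)
Lemma posD p q : pos p -> pos q -> pos (p + q).
Proof.
move=> pp qp; pose t := nrm p + nrm q + 1.
have [p0 q0] := (nrm_ge0 p, nrm_ge0 q).
have t0 : 0 < t by rewrite /t; lra.
have ti : 0 <= t^-1 by rewrite invr_ge0 ltW.
apply: (@pos_scale (2^-1 * t^-1)); first by rewrite mulr_gt0 ?invr_gt0.
apply: pos_ball; first by apply/saZ/saD; exact: pos_sa.
have -> : 1 - (2^-1 * t^-1)%:C *: (p + q) =
    2^-1%:C *: ((1 - t^-1%:C *: p) + (1 - t^-1%:C *: q)).
  rewrite -[X in X - _]half_double -scaleRA -scalerBr.
  by rewrite (scalerDr (t^-1)%:C) opprD addrACA.
rewrite nrmZ ger0_norm ?invr_ge0//.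
have := nrmD (1 - t^-1%:C *: p) (1 - t^-1%:C *: q).
have : nrm (1 - t^-1%:C *: p) <= 1.
  by apply/pos_nrm_1B; [exact: posZ|apply: nrm_scale_le1 => //; rewrite /t; lra].
have : nrm (1 - t^-1%:C *: q) <= 1.
  by apply/pos_nrm_1B; [exact: posZ|apply: nrm_scale_le1 => //; rewrite /t; lra].
lra.
Qed.

Lemma pos_sum n (f : 'I_n -> A) : (forall i, pos (f i)) -> pos (\sum_i f i).
Proof.
by move=> fp; apply: (big_ind pos) => [|a b|//]; [exact: pos0|exact: posD].
Qed.

(** [cstar_sqrt] works only in the ball around 1, which [h] enters after division by [t]. The root
    found there stays in the ball, so it is positive as well. *)
Lemma pos_sqrt h : pos h -> exists k,
  [/\ pos k, k * k = h & forall b, b * h = h * b -> b * k = k * b].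
Proof.
move=> hp; pose t := nrm h + 1.
have t0 : 0 < t by rewrite /t; have := nrm_ge0 h; lra.
have ti : 0 <= t^-1 by rewrite invr_ge0 ltW.
have hS := pos_sa hp.
have [||k [kS kh k1 kC]] := @cstar_sqrt (t^-1%:C *: h).
- exact: saZ.
- by apply/pos_nrm_1B; [exact: posZ|apply: nrm_scale_le1 => //; rewrite /t; lra].
exists ((Num.sqrt t)%:C *: k); split.
- by apply: posZ; [exact: sqrtr_ge0|exact: pos_ball].
- rewrite -cstar_scaleAl -cstar_scaleAr scaleRA -expr2 sqr_sqrtr ?ltW// kh.
  by rewrite scaleRA mulfV ?lt0r_neq0// scaleR1.
- move=> b bh; rewrite -cstar_scaleAr -cstar_scaleAl kC//.
  by rewrite -cstar_scaleAr -cstar_scaleAl bh.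
Qed.

(** Each square root commutes with all that commutes with its square, so the two roots commute and
    their product is a selfadjoint root of [p * q]. *)
Lemma posM p q : pos p -> pos q -> p * q = q * p -> pos (p * q).
Proof.
move=> /pos_sqrt[k [kp <- kC]] /pos_sqrt[m [mp <- mC]] pq.
have mk : m * k = k * m by apply: kC; apply/esym/mC.
exists (k * m); first by apply: saM => //; exact: pos_sa.
by rewrite -!mulrA (mulrA m k) mk -mulrA.
Qed.

(** For [w = 2 p - 1], the element [1 - w ^+ 2 = 4 p (1 - p)] is positive; with its square root, [w]
    forms a unitary. So [nrm w <= 1], and [2 p = w + 1] has norm at most 2. *)
Lemma pos_nrm_le1 p : pos p -> pos (1 - p) -> nrm p <= 1.
Proof.
move=> pp p1p; pose w := p + p - 1.
have wS : sa w by apply: saB (star1 A); apply: saD; exact: pos_sa.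
pose e := p * (1 - p).
have wE : 1 - w * w = (e + e) + (e + e).
  rewrite -mulrDl.
  rewrite /w; set d := p + p.
  have dd : d * d = d * p + d * p by rewrite -mulrDr.
  have -> : d * (1 - p) = d - d * p by rewrite mulrBr mulr1.
  rewrite addrACA -opprD -dd mulrBr mulrBl mul1r mulr1 !opprB addrA.
  by rewrite (addrC 1) subrK addrA.
have : pos (1 - w * w).
  have ep : pos e by apply: posM => //; rewrite mulrBr mulrBl mulr1 mul1r.
  by rewrite wE; do 2!apply: posD.
move=> /pos_sqrt[b [bp bE bC]].
have wb : w * b = b * w by apply: bC; apply: comm_1B; rewrite mulrA.
have := nrm_unitary_part wS (pos_sa bp) wb.
rewrite bE addrC subrK => /(_ erefl) w1.
have : nrm (p + p) <= 2.
  rewrite -[p + p](subrK 1); apply: le_trans (nrmD _ _) _.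
  by have := nrm1_le1 A; move: w1; rewrite /w; lra.
have -> : p + p = 2%:C *: p by rewrite (scaleRD 1 1) scaleR1.
by rewrite nrmZ ger0_norm//; lra.
Qed.
End Positivity.

(** * Monotonicity of the norm and positivity of [star x * x] *)

Section StarPositive.
Variables (R : realType) (A : unitalCstarType R).
Implicit Types (a b h k p q x y : A) (t : R).

(** For [t > nrm (p + q)], the element [1 - p / t] is the sum of the positive elements
    [1 - (p + q) / t] and [q / t]; so [nrm p <= t], and [t] can decrease to [nrm (p + q)]. *)
Lemma pos_nrm_le p q : pos p -> pos q -> nrm p <= nrm (p + q).
Proof.
move=> pp qp; apply/ler_addgt0Pl => e e0; set t := e + _.
have t0 : 0 < t by rewrite /t ltr_wpDr ?nrm_ge0.
have ti : 0 <= t^-1 by rewrite invr_ge0 ltW.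
have sp : pos (t^-1%:C *: (p + q)) by apply: posZ => //; exact: posD.
have s1 : nrm (t^-1%:C *: (p + q)) <= 1.
  by apply: nrm_scale_le1 => //; rewrite /t lerDr ltW.
have : nrm (t^-1%:C *: p) <= 1.
  apply: pos_nrm_le1; first exact: posZ.
  have -> : 1 - t^-1%:C *: p = 1 - t^-1%:C *: (p + q) + t^-1%:C *: q.
    by rewrite scalerDr opprD addrA subrK.
  apply: posD; last exact: posZ.
  by apply: pos_ball; [exact/sa1B/pos_sa|rewrite subKr].
by rewrite nrmZ gtr0_norm ?invr_gt0// ler_pdivrMl// mulr1.
Qed.

Lemma sa_starM x : sa (star x * x).
Proof. by rewrite /sa star_mul starK. Qed.

(* Twice this element is the sum of the squares of the selfadjoint elements
   [H] and [K]. *)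
Lemma pos_starM_add x : pos (x * star x + star x * x).
Proof.
pose H := x + star x; pose K := 'i%R *: (x - star x).
have HS : sa H by rewrite /sa star_add starK addrC.
have KS : sa K by rewrite /sa starZ conjCi star_sub starK scaleNr -scalerN opprB.
have KK : K * K = - ((x - star x) * (x - star x)).
  by rewrite -cstar_scaleAl -cstar_scaleAr scalerA -(expr2 'i%R) sqrCi scaleN1r.
rewrite -[X in pos X]half_double; apply: posZ; first by rewrite invr_ge0.
suff -> : x * star x + star x * x + (x * star x + star x * x) = H * H + K * K.
  by apply: posD; exact: pos_sqr.
have sq u v : (u + v) * (u + v) - (u - v) * (u - v) =
    u * v + v * u + (u * v + v * u) :> A.
  have sqE w z : (w + z) * (w + z) = (w * w + z * z) + (w * z + z * w) :> A.
    by rewrite mulrDr !mulrDl (addrC (w * z)) addrACA (addrC (z * w)).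
  by rewrite !sqE !(mulrN, mulNr) opprK -opprD opprB addrC subrKA.
by rewrite KK sq.
Qed.

(** Otherwise scale [y] to [z] of norm 1. Then [r = z * star z] is positive, because its sum with
    [star z * z] is. The element [u = (1 + r) * z = z * (1 + star z * z)] has norm at most 1, hence
    so does [u * star u = r + 2 r ^+ 2 + r ^+ 3]; but this dominates [2 r ^+ 2], of norm 2. *)
Lemma neg_starM_eq0 y : pos (- (star y * y)) -> y = 0.
Proof.
move=> sp; apply: contrapT => y0.
have n0 := nrm_gt0 y0; pose t := (nrm y)^-1; pose z := t%:C *: y.
have t0 : 0 < t by rewrite invr_gt0.
have z1 : nrm z = 1 by rewrite nrmZ gtr0_norm// mulVf// lt0r_neq0.
have zp : pos (- (star z * z)).
  rewrite star_scale -cstar_scaleAl -cstar_scaleAr -!scalerN.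
  by do 2!(apply: posZ; first exact: ltW).
have w1 : nrm (1 + star z * z) <= 1.
  rewrite -[star z * z]opprK; apply: pos_nrm_1B => //.
  by rewrite nrmN nrm_starM z1 expr1n.
pose r := z * star z.
have rp : pos r.
  rewrite /r -[z * star z](addrK (star z * z)).
  by apply: posD => //; exact: pos_starM_add.
have r1 : nrm r = 1 by rewrite /r -{1}(starK z) nrm_starM nrm_star z1 expr1n.
have rS := pos_sa rp.
have zr : z * (1 + star z * z) = (1 + r) * z.
  by rewrite mulrDr mulrDl mulr1 mul1r mulrA.
have u1 : nrm ((1 + r) * z) <= 1.
  rewrite -zr; apply: le_trans (nrmM _ _) _.
  by rewrite z1 mul1r.
have : nrm ((1 + r) * r * (1 + r)) <= 1.
  have -> : (1 + r) * r * (1 + r) = star (star ((1 + r) * z)) * star ((1 + r) * z).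
    by rewrite starK star_mul star_add star1 rS /r !mulrA.
  by rewrite nrm_starM nrm_star; have := nrm_ge0 ((1 + r) * z); nra.
have -> : (1 + r) * r * (1 + r) = (r * r + r * r) + (r + r * r * r).
  rewrite mulrDr mulr1 !mulrDl mul1r.
  by rewrite (addrC r (r * r)) addrACA.
have rrp : pos (r * r) by exact: pos_sqr.
have := pos_nrm_le (posD rrp rrp) (posD rp (posM rrp rp (esym (mulrA _ _ _)))).
have -> : r * r + r * r = 2%:C *: (r * r).
  by rewrite (scaleRD 1 1) scaleR1.
by rewrite nrmZ nrm_sqr// r1 ger0_norm//; lra.
Qed.

(* With [m] the square root of [h ^+ 2], twice the negative part of [h] is
   [v := m - h], and [y := x * v] satisfies [- star y * y = v * m * v >= 0]. *)
Lemma pos_starM x : pos (star x * x).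
Proof.
pose h := star x * x; have hS : sa h := sa_starM x.
have [m [mp mE mC]] := pos_sqrt (pos_sqr hS).
have mh : m * h = h * m by apply/esym/mC; rewrite mulrA.
have [b [bp bE bC]] := pos_sqrt mp.
pose v := m - h; have vS : sa v by apply: saB => //; exact: pos_sa.
have vm : v * m = m * v by rewrite mulrBl mulrBr mh.
have vb := bC _ vm.
have hv : h * v = - (m * v) by rewrite !mulrBr mE mh opprB.
have vv : v * v = m * v + m * v by rewrite {1}/v mulrBl hv opprK.
have y0 : x * v = 0.
  apply: neg_starM_eq0; rewrite star_mul vS.
  have -> : - (v * star x * (x * v)) = (b * v) * (b * v).
    by rewrite -!mulrA (mulrA (star x)) -/h hv mulrN opprK -bE !mulrA vb.
  apply: pos_sqr; apply: saM => //; exact: pos_sa.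
have vmv : v * (m * v) = 0.
  have : v * (h * v) = 0 by rewrite -(mulrA (star x)) y0 !mulr0.
  by rewrite hv mulrN => /(congr1 -%R); rewrite opprK oppr0.
(* The cube of the selfadjoint [v] vanishes, hence so does [nrm v ^+ 4], the norm of its fourth
   power. *)
have v3 : v * (v * v) = 0 by rewrite vv mulrDr vmv addr0.
have /nrm_eq0 v0 : nrm v = 0.
  have := nrm_sqr (saM vS vS erefl).
  rewrite -mulrA v3 mulr0 nrm0 nrm_sqr// => /esym/eqP.
  by rewrite !expf_eq0 /= => /eqP.
by have -> : star x * x = m by apply/esym/eqP; rewrite -subr_eq0 -/h -/v v0.
Qed.

Lemma pos_conj a h : pos h -> pos (star a * h * a).
Proof.
move=> [k kS <-]; have -> : star a * (k * k) * a = star (k * a) * (k * a).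
  by rewrite star_mul kS !mulrA.
exact: pos_starM.
Qed.

End StarPositive.

(** * The standard Hilbert module *)

Section BlockInner.
Variables (R : realType) (A : unitalCstarType R).
Implicit Types (a b h : A) (x y z : sequ A) (t : R).

Lemma sequZE (a : A^c) x i : (a *: x) i = x i * (a : A).
Proof. by []. Qed.

Lemma sequDE x y i : (x + y) i = x i + y i.
Proof. by []. Qed.

Lemma sequNE x i : (- x) i = - x i.
Proof. by []. Qed.

(** Inner product over one block of coordinates. Being a finite sum, it makes sense for all
    sequences, so the inequalities can be settled before any convergence; small tail blocks then
    express membership in [ell2]. *)
Definition bip m n x y : A := \sum_(m <= i < n) star (x i) * y i.

Lemma bipDr m n x y z : bip m n x (y + z) = bip m n x y + bip m n x z.
Proof. by rewrite -big_split; apply: eq_bigr => i _; rewrite /= -mulrDr. Qed.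

Lemma bipZr m n (a : A^c) x y : bip m n x (a *: y) = bip m n x y * (a : A).
Proof. by rewrite /bip mulr_suml; apply: eq_bigr => i _; rewrite sequZE mulrA. Qed.

Lemma bip_star m n x y : star (bip m n x y) = bip m n y x.
Proof. by rewrite star_sum; apply: eq_bigr => i _; rewrite star_mul starK. Qed.

Lemma bipDl m n x y z : bip m n (x + y) z = bip m n x z + bip m n y z.
Proof. by rewrite -bip_star bipDr star_add !bip_star. Qed.

Lemma bipZl m n (a : A^c) x y : bip m n (a *: x) y = star (a : A) * bip m n x y.
Proof. by rewrite -bip_star bipZr star_mul bip_star. Qed.

Lemma bipNr m n x y : bip m n x (- y) = - bip m n x y.
Proof. by rewrite -scaleN1r bipZr mulrN1. Qed.

Lemma bipNl m n x y : bip m n (- x) y = - bip m n x y.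
Proof. by rewrite -bip_star bipNr star_opp bip_star. Qed.

Lemma bip_pos m n x : pos (bip m n x x).
Proof.
rewrite /bip; apply: (big_ind (@pos R A)) => [|a b|i _]; first exact: pos0.
  exact: posD.
exact: pos_starM.
Qed.

Lemma pos_scalarB t h : 0 < t -> pos h -> nrm h <= t -> pos (t%:C *: (1 : A) - h).
Proof.
move=> t0 hp ht; have ti : 0 < t^-1 by rewrite invr_gt0.
apply: (pos_scale ti); rewrite scalerBr scaleRA mulVf ?lt0r_neq0// scaleR1.
apply: pos_ball; first by apply/sa1B/saZ/pos_sa.
by rewrite subKr nrm_scale_le1.
Qed.

(* The Cauchy-Schwarz inequality, from the positivity of the square of
   [x * (t^-1 a) - y], where [a] is the inner product of [x] and [y], and from
   [star a * (t - <x, x>) * a >= 0]. *)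
Lemma bip_CS m n x y :
  nrm (bip m n x y) ^+ 2 <= nrm (bip m n x x) * nrm (bip m n y y).
Proof.
set a := bip m n x y; set P := bip m n x x; set Q := bip m n y y.
(* A strict upper bound [t] of [nrm P] is invertible even when [P] vanishes. *)
suff tle t : nrm P < t -> nrm a ^+ 2 <= t * nrm Q.
  apply/ler_addgt0Pl => e e0; have Q0 := nrm_ge0 Q.
  have := tle (nrm P + e / (nrm Q + 1)); rewrite ltrDl divr_gt0 ?ltr_wpDl//.
  move=> /(_ isT); move/le_trans; apply; rewrite mulrDl addrC lerD2r.
  by rewrite mulrAC ler_pdivrMr ?ltr_wpDl// ler_pM2l// lerDl.
move=> Pt; have t0 : 0 < t by apply: le_lt_trans Pt; exact: nrm_ge0.
have ti : 0 < t^-1 by rewrite invr_gt0.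
have Pp : pos P := bip_pos m n x.
have p1 := bip_pos m n ((t^-1%:C *: a : A^c) *: x - y).
have p2 := posZ (ltW (mulr_gt0 ti ti))
  (pos_conj a (pos_scalarB t0 Pp (ltW Pt))).
have p3 : pos (t^-1%:C *: (star a * a)) by apply: posZ (ltW ti) (pos_starM a).
have QE : Q = t^-1%:C *: (star a * a) +
    (bip m n ((t^-1%:C *: a : A^c) *: x - y) ((t^-1%:C *: a : A^c) *: x - y) +
     (t^-1 * t^-1)%:C *: (star a * (t%:C *: (1 : A) - P) * a)).
  rewrite bipDr !bipDl bipNr !bipNl bipNr !bipZr !bipZl -/P -/a -/Q opprK.
  rewrite -(bip_star m n x y) -/a star_scale -!cstar_scaleAl -!cstar_scaleAr.
  rewrite mulrBr mulrBl -cstar_scaleAr mulr1 -cstar_scaleAl scalerBr scaleRA.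
  rewrite scaleRA -(mulrA t^-1) mulVf ?lt0r_neq0// mulr1.
  set u := _ *: (star a * a); set v := _ *: (star a * P * a).
  by rewrite -(opprB u v) (addrAC _ (- u + Q)) addNr add0r addNKr.
have := pos_nrm_le p3 (posD p1 p2); rewrite -QE nrmZ gtr0_norm// nrm_starM.
by rewrite ler_pdivrMl.
Qed.

Definition bnrm m n x : R := Num.sqrt (nrm (bip m n x x)).

Lemma bnrm_ge0 m n x : 0 <= bnrm m n x.
Proof. exact: sqrtr_ge0. Qed.

Lemma bnrm_sqr m n x : bnrm m n x ^+ 2 = nrm (bip m n x x).
Proof. by rewrite sqr_sqrtr// nrm_ge0. Qed.

Lemma le_of_sqr (u v : R) : 0 <= v -> u ^+ 2 <= v ^+ 2 -> u <= v.
Proof.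
move=> v0; rewrite -ler_sqrt ?sqr_ge0// !sqrtr_sqr (ger0_norm v0).
exact/le_trans/ler_norm.
Qed.

Lemma nrm_bip m n x y : nrm (bip m n x y) <= bnrm m n x * bnrm m n y.
Proof.
apply: le_of_sqr; first by rewrite mulr_ge0 ?bnrm_ge0.
by rewrite exprMn !bnrm_sqr bip_CS.
Qed.

Lemma bnrmD m n x y : bnrm m n (x + y) <= bnrm m n x + bnrm m n y.
Proof.
apply: le_of_sqr; first by rewrite addr_ge0 ?bnrm_ge0.
rewrite bnrm_sqr bipDr !bipDl; set a := bip _ _ x x; set c := bip _ _ y y.
have := nrmD (a + bip m n y x) (bip m n x y + c).
have := nrmD a (bip m n y x); have := nrmD (bip m n x y) c.
have := nrm_bip m n x y; have := nrm_bip m n y x.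
by rewrite -(bnrm_sqr m n x) -(bnrm_sqr m n y) !expr2; lra.
Qed.

Lemma bnrmZ m n (a : A^c) x : bnrm m n (a *: x) <= bnrm m n x * nrm (a : A).
Proof.
apply: le_of_sqr; first by rewrite mulr_ge0 ?bnrm_ge0 ?nrm_ge0.
rewrite exprMn !bnrm_sqr bipZr bipZl; apply: le_trans (nrmM _ _) _.
rewrite expr2 mulrA ler_wpM2r ?nrm_ge0// mulrC.
by apply: le_trans (nrmM _ _) _; rewrite nrm_star.
Qed.

Lemma bnrmN m n x : bnrm m n (- x) = bnrm m n x.
Proof. by rewrite /bnrm bipNr bipNl opprK. Qed.

Lemma bip_cat m n k x y : (m <= n)%N -> (n <= k)%N ->
  bip m k x y = bip m n x y + bip n k x y.
Proof. by move=> mn nk; rewrite /bip (big_cat_nat mn nk). Qed.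

Lemma bnrm_le m n m' n' x : (m' <= m)%N -> (m <= n)%N -> (n <= n')%N ->
  bnrm m n x <= bnrm m' n' x.
Proof.
move=> mm mn nn; rewrite ler_wsqrtr//.
rewrite (bip_cat _ _ mm (leq_trans mn nn)) (bip_cat _ _ mn nn) addrC -addrA.
by apply: pos_nrm_le; [exact: bip_pos|apply: posD; exact: bip_pos].
Qed.

Lemma bnrm1 n x : bnrm n n.+1 x = nrm (x n).
Proof. by rewrite /bnrm /bip big_nat1 nrm_starM sqrtr_sqr ger0_norm// nrm_ge0. Qed.

End BlockInner.

(** * The inner product and norm on [ell2], and completeness *)

Section HilbertNorm.
Variables (R : realType) (A : unitalCstarType R).
Implicit Types (a b : A) (x y z : sequ A) (t : R).

(** The Cauchy criterion for the defining series; it turns closure properties of [ell2] into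
    inequalities between blocks. *)
Lemma ell2P x : ell2 x <-> forall e : R, 0 < e -> exists N, forall m n,
  (N <= m)%N -> (m <= n)%N -> bnrm m n x < e.
Proof.
have bipE m n : (m <= n)%N -> bip m n x x = bip 0 n x x - bip 0 m x x.
  by move=> mn; rewrite (bip_cat _ _ (leq0n m) mn) addrAC subrr add0r.
split=> [/cvg_ex[l /tendsP xl] e e0|xC].
  have e2 : 0 < e ^+ 2 / 2 by rewrite divr_gt0// exprn_gt0.
  have [N _ Nl] := xl _ e2.
  exists N => m n Nm mn; rewrite -[e]gtr0_norm// -sqrtr_sqr ltr_sqrt ?exprn_gt0//.
  rewrite bipE//; apply: le_lt_trans (nrmDB _ l _) _; rewrite (nrmBC l).
  have := Nl m Nm; have := Nl n (leq_trans Nm mn); rewrite /= /series /=.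
  by rewrite /bip; lra.
suff [l xl] : exists l, tends (fun n => bip 0 n x x) l.
  by apply/cvg_ex; exists l; apply/tendsP.
apply: tends_complete => e e0.
have [|N NP] := xC (Num.sqrt e); first by rewrite sqrtr_gt0.
exists N => m n Nm mn; rewrite -bipE// -bnrm_sqr -[e]sqr_sqrtr ?ltW//.
by rewrite ltrXn2r ?bnrm_ge0 ?sqrtr_ge0//; exact: NP.
Qed.

Lemma ell2_0 : ell2 (0 : sequ A).
Proof.
apply/ell2P => e e0; exists 0%N => m n _ _.
by rewrite /bnrm /bip big1 ?nrm0 ?sqrtr0// => i _; rewrite mulr0.
Qed.

Lemma ell2D x y : ell2 x -> ell2 y -> ell2 (x + y).
Proof.
move=> /ell2P xP /ell2P yP; apply/ell2P => e e0.
have e2 : 0 < e / 2 by rewrite divr_gt0.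
have [[N NP] [M MP]] := (xP _ e2, yP _ e2).
exists (maxn N M) => m n; rewrite geq_max => /andP[Nm Mm] mn.
have := NP m n Nm mn; have := MP m n Mm mn; have := bnrmD m n x y; lra.
Qed.

Lemma ell2Z (a : A^c) x : ell2 x -> ell2 (a *: x).
Proof.
move=> /ell2P xP; apply/ell2P => e e0.
have a1 : 0 < nrm (a : A) + 1 by rewrite ltr_wpDl ?nrm_ge0.
have [|N NP] := xP (e / (nrm (a : A) + 1)); first exact: divr_gt0.
exists N => m n Nm mn; have := NP m n Nm mn; rewrite ltr_pdivlMr//.
by have := bnrmZ m n a x; have := bnrm_ge0 m n x; lra.
Qed.

Lemma ell2N x : ell2 x -> ell2 (- x).
Proof. by rewrite -scaleN1r; exact: ell2Z. Qed.

Lemma ell2B x y : ell2 x -> ell2 y -> ell2 (x - y).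
Proof. by move=> xP yP; apply: ell2D => //; exact: ell2N. Qed.

Lemma inner_tends x y : ell2 x -> ell2 y ->
  tends (fun n => bip 0 n x y) (inner x y).
Proof.
move=> /ell2P xP /ell2P yP.
suff [l xl] : exists l, tends (fun n => bip 0 n x y) l.
  suff -> : inner x y = l by [].
  by apply: cvg_lim => //; apply/tendsP.
apply: tends_complete => e e0.
have s0 : 0 < Num.sqrt e by rewrite sqrtr_gt0.
have [[N NP] [M MP]] := (xP _ s0, yP _ s0).
exists (maxn N M) => m n; rewrite geq_max => /andP[Nm Mm] mn.
rewrite (bip_cat _ _ (leq0n m) mn) addrAC subrr add0r.
apply: le_lt_trans (nrm_bip _ _ _ _) _.
rewrite -[e]sqr_sqrtr ?ltW// expr2.
by apply: ltr_pM; rewrite ?bnrm_ge0//; [exact: NP|exact: MP].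
Qed.

Lemma innerDr x y z : ell2 x -> ell2 y -> ell2 z ->
  inner x (y + z) = inner x y + inner x z.
Proof.
move=> xP yP zP; apply: tends_unique (inner_tends xP (ell2D yP zP)) _.
by under eq_fun do rewrite bipDr; apply: tendsD; exact: inner_tends.
Qed.

Lemma innerZr (a : A^c) x y : ell2 x -> ell2 y ->
  inner x (a *: y) = inner x y * (a : A).
Proof.
move=> xP yP; apply: tends_unique (inner_tends xP (@ell2Z a _ yP)) _.
by under eq_fun do rewrite bipZr; apply: tendsMr; exact: inner_tends.
Qed.

Lemma inner_star x y : ell2 x -> ell2 y -> star (inner x y) = inner y x.
Proof.
move=> xP yP; apply: tends_unique (inner_tends yP xP).
by under eq_fun do rewrite -bip_star; apply: tends_star; exact: inner_tends.
Qed.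

Lemma innerDl x y z : ell2 x -> ell2 y -> ell2 z ->
  inner (x + y) z = inner x z + inner y z.
Proof.
move=> xP yP zP; rewrite -inner_star ?innerDr ?star_add ?inner_star//.
exact: ell2D.
Qed.

Lemma innerZl (a : A^c) x y : ell2 x -> ell2 y ->
  inner (a *: x) y = star (a : A) * inner x y.
Proof.
move=> xP yP; rewrite -inner_star ?innerZr ?star_mul ?inner_star//.
exact: ell2Z.
Qed.

Lemma inner0r x : ell2 x -> inner x 0 = 0.
Proof. by move=> xP; rewrite -(scale0r (0 : sequ A)) innerZr ?mulr0//; exact: ell2_0. Qed.

Lemma inner_suml n (f : 'I_n -> sequ A) y : (forall i, ell2 (f i)) -> ell2 y ->
  ell2 (\sum_i f i) /\ inner (\sum_i f i) y = \sum_i inner (f i) y.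
Proof.
move=> fP yP; apply: (big_ind2 (fun x a => ell2 x /\ inner x y = a)) => //.
  by split; [exact: ell2_0|rewrite -inner_star ?inner0r ?star0//; exact: ell2_0].
by move=> x a z b [xP <-] [zP <-]; split; [exact: ell2D|rewrite innerDl].
Qed.

Definition hn x : R := Num.sqrt (nrm (inner x x)).

Lemma hnormE x : hnorm x = (hn x)%:C.
Proof.
rewrite /hnorm normE -[nrm _]sqr_sqrtr ?nrm_ge0// rmorphXn /= sqrCK//.
by rewrite ler0c sqrtr_ge0.
Qed.

Lemma hn_ge0 x : 0 <= hn x.
Proof. exact: sqrtr_ge0. Qed.

Lemma hn_sqr x : hn x ^+ 2 = nrm (inner x x).
Proof. by rewrite sqr_sqrtr// nrm_ge0. Qed.

Lemma bnrm_hn m n x : ell2 x -> bnrm m n x <= hn x.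
Proof.
move=> xP; have [mn|nm] := leqP m n; last first.
  by rewrite /bnrm /bip big_geq ?(ltnW nm)// nrm0 sqrtr0 hn_ge0.
rewrite ler_wsqrtr//; apply: tends_nrm_ge (inner_tends xP xP) _.
exists n => // k /= nk; rewrite -!bnrm_sqr ler_sqr ?nnegrE ?bnrm_ge0//.
exact: bnrm_le.
Qed.

Lemma hn_le x t : ell2 x -> (forall n, bnrm 0 n x <= t) -> hn x <= t.
Proof.
move=> xP xt; have t0 : 0 <= t by exact: le_trans (bnrm_ge0 _ _ _) (xt 0%N).
apply: le_of_sqr => //; rewrite hn_sqr.
apply: tends_nrm_le (inner_tends xP xP) _; apply: nearW => n.
by rewrite -bnrm_sqr ler_sqr ?nnegrE ?bnrm_ge0.
Qed.

Lemma nrm_inner x y : ell2 x -> ell2 y -> nrm (inner x y) <= hn x * hn y.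
Proof.
move=> xP yP; apply: tends_nrm_le (inner_tends xP yP) _; apply: nearW => n.
by apply: le_trans (nrm_bip _ _ _ _) _; rewrite ler_pM ?bnrm_ge0 ?bnrm_hn.
Qed.

Lemma hnD x y : ell2 x -> ell2 y -> hn (x + y) <= hn x + hn y.
Proof.
move=> xP yP; apply: hn_le (ell2D xP yP) _ => n.
by apply: le_trans (bnrmD _ _ _ _) _; rewrite lerD ?bnrm_hn.
Qed.

Lemma hnZ (a : A^c) x : ell2 x -> hn (a *: x) <= hn x * nrm (a : A).
Proof.
move=> xP; apply: hn_le (@ell2Z a _ xP) _ => n.
by apply: le_trans (bnrmZ _ _ _ _) _; rewrite ler_wpM2r ?nrm_ge0 ?bnrm_hn.
Qed.

Lemma hnN x : hn (- x) = hn x.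
Proof.
rewrite /hn /inner; under eq_fun do rewrite sequNE star_opp mulrNN.
by [].
Qed.

Lemma hnBC x y : hn (x - y) = hn (y - x).
Proof. by rewrite -hnN opprB. Qed.

Lemma hnB x y : ell2 x -> ell2 y -> hn (x - y) <= hn x + hn y.
Proof. by move=> xP yP; rewrite -(hnN y); apply: hnD => //; exact: ell2N. Qed.

Lemma hnDB x y z : ell2 x -> ell2 y -> ell2 z ->
  hn (x - z) <= hn (x - y) + hn (y - z).
Proof. by move=> xP yP zP; rewrite -(subrKA y x); apply: hnD; exact: ell2B. Qed.

Lemma hn0 : hn (0 : sequ A) = 0.
Proof. by rewrite /hn inner0r ?nrm0 ?sqrtr0//; exact: ell2_0. Qed.

Lemma nrm_coord x i : ell2 x -> nrm (x i) <= hn x.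
Proof. by move=> xP; rewrite -bnrm1 bnrm_hn. Qed.

Lemma hn_eq0 x : ell2 x -> hn x = 0 -> x = 0.
Proof.
move=> xP x0; apply/funext => i; apply: nrm_eq0; apply/eqP.
by rewrite eq_le nrm_ge0 -x0 nrm_coord.
Qed.

(** Sequences are a module over [A^c] only, so real scalars act through multiples of the unit. *)
Definition rs t : A^c := t%:C *: (1 : A).

Lemma rsM t u : rs t * rs u = rs (t * u).
Proof.
change (((u%:C *: (1 : A)) : A) * ((t%:C *: (1 : A)) : A) = rs (t * u) :> A).
by rewrite -cstar_scaleAl mul1r scaleRA mulrC.
Qed.

Lemma hn_rs t x : ell2 x -> hn (rs t *: x) = `|t| * hn x.
Proof.
move=> xP; rewrite /hn innerZr ?innerZl//; last exact: ell2Z.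
rewrite /rs star_scale star1 -cstar_scaleAl mul1r -cstar_scaleAr mulr1.
by rewrite scaleRA nrmZ sqrtrM ?normr_ge0// -expr2 normrX sqrtr_sqr normr_id.
Qed.

Lemma bnrm_recr n x : bnrm 0 n.+1 x <= bnrm 0 n x + nrm (x n).
Proof.
apply: le_of_sqr; first by rewrite addr_ge0 ?bnrm_ge0 ?nrm_ge0.
rewrite bnrm_sqr /bip big_nat_recr//=; apply: le_trans (nrmD _ _) _.
rewrite -/(bip 0 n x x) -bnrm_sqr nrm_starM sqrrD lerD2r lerDl.
by rewrite mulrn_wge0// mulr_ge0 ?bnrm_ge0 ?nrm_ge0.
Qed.

(** The coordinates converge, hence so do the norms of each fixed finite block. The Cauchy bound
    then passes to the limit uniformly in the length of the block, which puts the coordinatewise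
    limit in [ell2] and gives convergence in norm. *)
Lemma ell2_complete (u : nat -> sequ A) : (forall n, ell2 (u n)) ->
  (forall e : R, 0 < e -> exists N, forall m n, (N <= m)%N -> (m <= n)%N ->
     hn (u n - u m) < e) ->
  exists2 x, ell2 x & forall e : R, 0 < e ->
    exists N, forall n, (N <= n)%N -> hn (u n - x) < e.
Proof.
move=> uP uC.
have /boolp.choice[x xE] : forall i, exists a, tends (fun n => u n i) a.
  move=> i; apply: tends_complete => e /uC[N NP].
  exists N => m n Nm mn; apply: le_lt_trans (NP m n Nm mn).
  exact: (nrm_coord i (ell2B (uP n) (uP m))).
have ux k (d : R) : 0 < d -> \forall n \near \oo, bnrm 0 k (u n - x) < d.
  elim: k d => [|k IH] d d0.
    by apply: nearW => n; rewrite /bnrm /bip big_geq// nrm0 sqrtr0.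
  have d2 : 0 < d / 2 by rewrite divr_gt0.
  near=> n; apply: le_lt_trans (bnrm_recr _ _) _.
  rewrite [ltRHS](splitr d); apply: ltrD; near: n; first exact: IH.
  exact: xE.
have uxN (e : R) : 0 < e -> exists N, forall m k, (N <= m)%N ->
    bnrm 0 k (u m - x) <= e.
  move=> /uC[N NP]; exists N => m k Nm; apply/ler_addgt0Pl => d d0.
  near \oo => n; rewrite -(subrKA (u n)); apply: le_trans (bnrmD _ _ _ _) _.
  rewrite addrC; apply: lerD; first by apply: ltW; near: n; exact: ux.
  apply: le_trans (bnrm_hn _ _ (ell2B (uP m) (uP n))) _; rewrite hnBC ltW//.
  by apply: NP => //; near: n; exists m.
have xP : ell2 x.
  apply/ell2P => e e0; have e2 : 0 < e / 2 by rewrite divr_gt0.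
  have [N NP] := uxN _ e2; have /ell2P/(_ _ e2)[M MP] := uP N.
  exists M => p q Mp pq; rewrite -[x](subKr (u N)).
  apply: le_lt_trans (bnrmD _ _ _ _) _; rewrite bnrmN.
  have := MP p q Mp pq; have := NP N q (leqnn N).
  by have := bnrm_le (u N - x) (leq0n p) pq (leqnn q); lra.
exists x => // e e0; have e2 : 0 < e / 2 by rewrite divr_gt0.
have [N NP] := uxN _ e2; exists N => n Nn.
have : hn (u n - x) <= e / 2 by apply: hn_le (ell2B (uP n) xP) _ => k; exact: NP.
lra.
Unshelve. all: by end_near. Qed.

End HilbertNorm.

(** * Limits in a closed submodule and perturbation of surjections *)

Section ClosedSubmodules.
Variables (R : realType) (A : unitalCstarType R) (P : closed_submodule A).
Implicit Types (x y z : sequ A) (t : R).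

Lemma csZ (a : A^c) x : cs_set P x -> cs_set P (a *: x).
Proof. by move=> xP; rewrite -[_ *: _]addr0; apply: cs_lin => //; exact: cs_zero. Qed.

Lemma csD x y : cs_set P x -> cs_set P y -> cs_set P (x + y).
Proof. by move=> xP yP; rewrite -[x]scale1r; exact: cs_lin. Qed.

Lemma csN x : cs_set P x -> cs_set P (- x).
Proof. by rewrite -scaleN1r; exact: csZ. Qed.

Lemma csB x y : cs_set P x -> cs_set P y -> cs_set P (x - y).
Proof. by move=> xP yP; apply: csD => //; exact: csN. Qed.

Lemma cs_sum n (f : 'I_n -> sequ A) :
  (forall i, cs_set P (f i)) -> cs_set P (\sum_i f i).
Proof.
by move=> fP; apply: (big_ind (cs_set P)) => [|x y|//]; [exact: cs_zero|exact: csD].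
Qed.

Lemma cs_limit x : ell2 x ->
  (forall e : R, 0 < e -> exists2 y, cs_set P y & hn (x - y) < e) -> cs_set P x.
Proof.
move=> xl xP; apply: cs_closed => // e e0.
have er : e = (complex.Re e)%:C by rewrite RRe_real ?gtr0_real.
move: e0; rewrite er ltcR => /xP[y yP xy].
by exists y => //; rewrite hnormE ltcR.
Qed.

Lemma cs_geometric (u : nat -> sequ A) C : (forall n, cs_set P (u n)) ->
  (forall n, hn (u n.+1 - u n) <= C * 2^-1 ^+ n) ->
  exists2 x, cs_set P x & forall e : R, 0 < e ->
    exists N, forall n, (N <= n)%N -> hn (u n - x) < e.
Proof.
move=> uP uC; have ul n := cs_sub (uP n).
have C0 : 0 <= C by have := le_trans (hn_ge0 _) (uC 0%N); rewrite expr0 mulr1.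
have g0 n : 0 <= 2^-1 ^+ n :> R by rewrite exprn_ge0// invr_ge0.
(* The bound is exactly [C] times the sum of the [2^-1 ^+ k] for [m <= k < n], so the induction
   closes. *)
have ud m n : (m <= n)%N -> hn (u n - u m) <= C * (2 * 2^-1 ^+ m - 2 * 2^-1 ^+ n).
  move=> /subnKC <-; elim: (n - m)%N => [|d IH].
    by rewrite addn0 !subrr mulr0 hn0.
  rewrite addnS; apply: le_trans (hnDB (ul _) (ul (m + d)%N) (ul _)) _.
  by have := uC (m + d)%N; rewrite exprS; move: IH; lra.
have [|x xl ux] := ell2_complete ul; last first.
  exists x => //; apply: cs_limit => // e /ux[N NP].
  by exists (u N); rewrite // hnBC NP.
move=> e e0; have C1 : 0 < 2 * (C + 1) by rewrite mulr_gt0// ltr_wpDl.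
have [N _ NP] : \forall n \near \oo, (2^-1 : R) ^+ n < e / (2 * (C + 1)).
  have /cvgrPdist_lt/(_ _ (divr_gt0 e0 C1)) : (fun n => (2^-1 : R) ^+ n) @ \oo --> 0.
    by apply: cvg_expr; rewrite ger0_norm ?invr_ge0// invf_lt1// ltr1n.
  by apply: filterS => n; rewrite sub0r normrN ger0_norm.
exists N => m n Nm mn; apply: le_lt_trans (ud _ _ mn) _.
have := NP m Nm; rewrite /= ltr_pdivlMr// => me.
apply: le_lt_trans me; have := g0 m; have := mulr_ge0 C0 (g0 n); lra.
Qed.

(* Solving [L x - D x = y] by iterating [y <- D (L^-1 y)]. *)
Lemma perturb_surjective (L D : sequ A -> sequ A) (g C : R) : 0 < g ->
  (forall x, cs_set P x -> cs_set P (D x)) ->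
  (forall x y, cs_set P x -> cs_set P y -> L (x + y) = L x + L y) ->
  (forall x y, cs_set P x -> cs_set P y -> D (x + y) = D x + D y) ->
  (forall x, cs_set P x -> hn (L x - D x) <= C * hn x) ->
  (forall x, cs_set P x -> g * hn x <= hn (L x)) ->
  (forall x, cs_set P x -> hn (D x) <= g / 2 * hn x) ->
  (forall x, cs_set P x -> cs_set P (L x)) ->
  (forall y, cs_set P y -> exists2 x, cs_set P x & L x = y) ->
  forall y, cs_set P y -> exists2 x, cs_set P x & L x - D x = y.
Proof.
move=> g0 DP LD DD LC Lg Dg LP Ls y yP.
have /boolp.choice[G GE] : forall z, exists x, cs_set P z -> cs_set P x /\ L x = z.
  move=> z; have [/Ls[x xP xz]|zP] := pselect (cs_set P z); first by exists x.
  by exists 0.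
(* [X n] is the approximate solution after [n] corrections and [r n] the error that remains; since
   [D] costs a factor [g / 2] and [G] a factor [g^-1], each error is at most half the previous
   one. *)
pose fix r n := if n is m.+1 then D (G (r m)) else y.
pose fix X n := if n is m.+1 then X m + G (r m) else 0.
have rP n : cs_set P (r n) by elim: n => //= n /GE[GP _]; exact: DP.
have GP n : cs_set P (G (r n)) by have [] := GE _ (rP n).
have GL n : L (G (r n)) = r n by have [] := GE _ (rP n).
have XP n : cs_set P (X n).
  by elim: n => [|n IH] /=; [exact: cs_zero|exact: csD].
have L0 : L 0 = 0.
  by apply: (addrI (L 0)); rewrite -LD ?addr0//; exact: cs_zero.
have D0 : D 0 = 0.
  by apply: (addrI (D 0)); rewrite -DD ?addr0//; exact: cs_zero.
have XE n : L (X n) - D (X n) = y - r n.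
  elim: n => [|n IH] /=; first by rewrite L0 D0 !subrr.
  by rewrite LD// DD// GL opprD addrACA IH subrKA.
have Gg n : hn (G (r n)) <= hn (r n) / g.
  by rewrite ler_pdivlMr// mulrC -{2}GL Lg.
have rn n : hn (r n) <= hn y * 2^-1 ^+ n.
  elim: n => [|n IH] /=; first by rewrite expr0 mulr1.
  apply: le_trans (Dg _ (GP n)) _.
  apply: le_trans (ler_wpM2l _ (Gg n)) _; first by rewrite divr_ge0// ltW.
  have -> : g / 2 * (hn (r n) / g) = hn (r n) / 2 by field; exact: lt0r_neq0.
  by rewrite exprS; lra.
have [||x xP Xx] := @cs_geometric X (hn y / g) => //.
  move=> n; rewrite /= addrAC subrr add0r; apply: le_trans (Gg n) _.
  by rewrite mulrAC ler_wpM2r// invr_ge0 ltW.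
have xl := cs_sub xP; have yl := cs_sub yP.
exists x => //; apply/eqP; rewrite -subr_eq0; apply/eqP.
have zP : cs_set P (L x - D x - y).
  by apply: csB => //; apply: csB; [exact: LP|exact: DP].
apply: hn_eq0; first exact: cs_sub zP.
apply/eqP; rewrite eq_le hn_ge0 andbT; apply/ler_addgt0Pl => e e0; rewrite addr0.
have C0 : 0 < `|C| + 1 by rewrite ltr_wpDl.
have e2 : 0 < e / 2 by rewrite divr_gt0.
have [N NP] := Xx _ (divr_gt0 e2 C0).
have y1 : 0 < hn y + 1 by rewrite ltr_wpDl ?hn_ge0.
have [M _ MP] : \forall n \near \oo, (2^-1 : R) ^+ n < e / 2 / (hn y + 1).
  have /cvgrPdist_lt/(_ _ (divr_gt0 e2 y1)) : (fun n => (2^-1 : R) ^+ n) @ \oo --> 0.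
    by apply: cvg_expr; rewrite ger0_norm ?invr_ge0// invf_lt1// ltr1n.
  by apply: filterS => n; rewrite sub0r normrN => /(le_lt_trans (ler_norm _)).
pose n := maxn N M.
have xn : cs_set P (x - X n) by exact: csB.
have -> : L x - D x - y = (L (x - X n) - D (x - X n)) - r n.
  have LE : L x = L (x - X n) + L (X n) by rewrite -LD// subrK.
  have DE : D x = D (x - X n) + D (X n) by rewrite -DD// subrK.
  rewrite LE DE opprD addrACA XE.
  by rewrite -(addrA _ (y - r n)) (addrAC y) subrr add0r.
have zl : ell2 (L (x - X n) - D (x - X n)).
  by apply: cs_sub (csB (LP _ xn) (DP _ xn)).
apply: le_trans (hnB zl (cs_sub (rP n))) _.
have h1 : hn (L (x - X n) - D (x - X n)) <= e / 2.
  apply: le_trans (LC _ xn) _.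
  have := NP n (leq_maxl _ _); rewrite hnBC ltr_pdivlMr// mulrC => /ltW; apply: le_trans.
  by rewrite ler_wpM2r ?hn_ge0// (le_trans (ler_norm _))// lerDl.
have h2 : hn (r n) <= e / 2.
  apply: le_trans (rn n) _.
  have := MP n (leq_maxr _ _); rewrite /= ltr_pdivlMr// mulrC => /ltW; apply: le_trans.
  by rewrite ler_wpM2r ?exprn_ge0 ?invr_ge0// lerDl.
lra.
Qed.

End ClosedSubmodules.

(** * Finitely generated closed submodules *)

Section FrameOperator.
Variables (R : realType) (A : unitalCstarType R) (P : closed_submodule A).
Variables (n : nat) (p : 'I_n -> sequ A).
Hypothesis pP : forall i, cs_set P (p i).
Hypothesis pG : forall x, cs_set P x -> exists a : 'I_n -> A^c,
  x = \sum_i a i *: p i.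
Implicit Types (x y z : sequ A) (t : R).

Let pl i : ell2 (p i) := cs_sub (pP i).

Definition tau x : R := \sum_i nrm (inner (p i) x).

Lemma tau_ge0 x : 0 <= tau x.
Proof. by apply: sumr_ge0 => i _; exact: nrm_ge0. Qed.

(** Expanding [y] along the generators shows that an element almost orthogonal to them is almost
    orthogonal to [y], with a constant that depends on [y] alone. *)
Lemma tau_inner y : cs_set P y -> exists2 c : R, 0 <= c &
  forall z, ell2 z -> nrm (inner z y) <= tau z * c.
Proof.
move=> yP; have [a ya] := pG yP; exists (\sum_i nrm (a i : A)).
  by apply: sumr_ge0 => i _; exact: nrm_ge0.
move=> z zl; have yl := cs_sub yP.
rewrite -nrm_star inner_star// {1}ya.
have fl i : ell2 (a i *: p i) by exact: ell2Z.
have [_ ->] := inner_suml fl zl.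
apply: le_trans (nrm_sum _) _; rewrite mulr_sumr; apply: ler_sum => i _.
rewrite innerZl// mulrC; apply: le_trans (nrmM _ _) _; rewrite nrm_star.
rewrite ler_wpM2l ?nrm_ge0// /tau (bigD1 i)//= lerDl.
by apply: sumr_ge0 => j _; exact: nrm_ge0.
Qed.

Lemma tau_rs t x : ell2 x -> tau (rs A t *: x) = `|t| * tau x.
Proof.
move=> xl; rewrite /tau mulr_sumr; apply: eq_bigr => i _.
by rewrite innerZr// /rs -cstar_scaleAr mulr1 nrmZ.
Qed.

(* A gliding hump: otherwise there are [y k] in [P] with norm [4 ^+ k] which
   are almost orthogonal to the generators, hence to each other and to every
   fixed element of [P], whereas the inner product of [y k] with the sum of the
   [8 ^- j *: y j] is at least [2 ^+ k - 2]. *)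
Lemma tau_bounded_below : exists2 d : R, 0 < d &
  forall x, cs_set P x -> d * hn x <= tau x.
Proof.
apply: contrapT => nd.
have small (b e : R) : 0 < b -> 0 < e ->
    exists y, [/\ cs_set P y, hn y = b & tau y <= e].
  move=> b0 e0; have d0 := divr_gt0 e0 b0.
  have [x xP xd] : exists2 x, cs_set P x & tau x < e / b * hn x.
    apply: contrapT => nx; apply: nd; exists (e / b) => // x xP.
    by rewrite leNgt; apply/negP => xt; apply: nx; exists x.
  have xl := cs_sub xP.
  have x0 : 0 < hn x.
    by have := le_lt_trans (tau_ge0 x) xd; rewrite pmulr_rgt0.
  exists (rs A (b / hn x) *: x); split; first exact: csZ.
    by rewrite hn_rs// gtr0_norm ?divr_gt0// divfK ?lt0r_neq0.
  rewrite tau_rs// gtr0_norm ?divr_gt0// mulrAC ler_pdivrMr// mulrC.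
  by move: (ltW xd); rewrite mulrAC ler_pdivlMr.
have /boolp.choice[Y YP] : forall ks : nat * R, exists y,
    [/\ cs_set P y, hn y = 4 ^+ ks.1 & tau y <= (1 + `|ks.2|)^-1].
  by move=> [k s]; apply: small; rewrite ?exprn_gt0// invr_gt0 ltr_pwDl.
have /boolp.choice[al alP] : forall y, exists c : R, 0 <= c /\
    (cs_set P y -> forall z, ell2 z -> nrm (inner z y) <= tau z * c).
  move=> y; have [/tau_inner[c c0 cP]|yP] := pselect (cs_set P y); first by exists c.
  by exists 0.
(* [s k] accumulates the constants of all earlier [y j], so that [tau (y k) * al (y j) <= 1] for
   [j < k]. *)
pose fix s k : R := if k is j.+1 then s j + al (Y (j, s j)) else 0.
pose y k := Y (k, s k).
have s0 k : 0 <= s k.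
  by elim: k => //= k IH; rewrite addr_ge0//; have [] := alP (Y (k, s k)).
have yP k : cs_set P (y k) by have [] := YP (k, s k).
have yl k := cs_sub (yP k).
have yn k : hn (y k) = 4 ^+ k by have [] := YP (k, s k).
have yt k : tau (y k) <= (1 + s k)^-1.
  by have [_ _] := YP (k, s k); rewrite /= ger0_norm.
have sj j k : (j < k)%N -> al (y j) <= s k.
  elim: k => // k IH; rewrite ltnS leq_eqVlt => /orP[/eqP->|/IH jk] /=.
    by rewrite lerDr.
  by apply: le_trans jk _; rewrite lerDl; have [] := alP (Y (k, s k)).
have yy1 j k : (j < k)%N -> nrm (inner (y k) (y j)) <= 1.
  move=> jk; have [al0 /(_ (yP j) (y k) (yl k))] := alP (y j).
  move/le_trans; apply; have := sj _ _ jk; have := yt k => ytk sjk.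
  have sk1 : 0 < 1 + s k by rewrite ltr_pwDl.
  apply: le_trans (ler_pM (tau_ge0 _) al0 ytk sjk) _.
  by rewrite ler_pdivrMl// mulr1 lerDr.
have yy j k : (j != k)%N -> nrm (inner (y k) (y j)) <= 1.
  rewrite neq_ltn => /orP[/yy1//|kj].
  by rewrite -inner_star// nrm_star yy1.
(* With these weights the terms have norm [8^-1 ^+ j * 4 ^+ j = 2^-1 ^+ j] and are summable, whereas
   the diagonal inner products have norm [8^-1 ^+ k * 16 ^+ k = 2 ^+ k]. *)
pose c (j : nat) : R := 8^-1 ^+ j.
have c0 j : 0 <= c j by rewrite exprn_ge0// invr_ge0.
have ch j : c j <= 2^-1 ^+ j by apply: lerXn2r; rewrite ?nnegrE ?invr_ge0//; lra.
pose fix X m := if m is j.+1 then X j + rs A (c j) *: y j else 0.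
have XP m : cs_set P (X m).
  by elim: m => [|m IH] /=; [exact: cs_zero|apply: csD => //; exact: csZ].
have Xl m := cs_sub (XP m).
have [|x xP Xx] := cs_geometric (C := 1) XP.
  move=> m; rewrite /= addrAC subrr add0r hn_rs// ger0_norm// yn mul1r -exprMn.
  by rewrite le_eqVlt (_ : 8^-1 * 4 = 2^-1 :> R) ?eqxx//; lra.
have xl := cs_sub xP.
have [al0 /(_ xP)xal] := alP x.
have XS k m : inner (y k) (X m.+1) =
    inner (y k) (X m) + (c m)%:C *: inner (y k) (y m).
  rewrite /= innerDr//; last exact: ell2Z.
  by rewrite innerZr// /rs -cstar_scaleAr mulr1.
have lo k m : (m <= k)%N -> nrm (inner (y k) (X m)) <= 2 - 2 * 2^-1 ^+ m.
  elim: m => [|m IH] mk; first by rewrite /= inner0r// nrm0 expr0; lra.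
  rewrite XS; apply: le_trans (nrmD _ _) _; rewrite nrmZ ger0_norm//.
  have := IH (ltnW mk); have := ch m; have := c0 m.
  have := yy m k; rewrite neq_ltn mk => /(_ isT).
  by have := nrm_ge0 (inner (y k) (y m)); rewrite exprS; nra.
(* The diagonal term contributes [2 ^+ k], and all others together cost at most the sum of the
   [2^-1 ^+ j], which is 2; the summand [2 * 2^-1 ^+ m] is the part of this budget not yet spent. *)
have hi k m : (k < m)%N -> 2 ^+ k - 2 + 2 * 2^-1 ^+ m <= nrm (inner (y k) (X m)).
  elim: m => // m IH; rewrite ltnS leq_eqVlt => /orP[/eqP<-|km].
    have := lo k k (leqnn k).
    have : nrm ((c k)%:C *: inner (y k) (y k)) <=
        nrm (inner (y k) (X k.+1)) + nrm (inner (y k) (X k)).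
      by rewrite XS -{1}(addKr (inner (y k) (X k)) (_ *: _)) addrC nrmB.
    rewrite nrmZ ger0_norm// -hn_sqr yn -exprM mulnC exprM -exprMn.
    rewrite (_ : 8^-1 * 4 ^+ 2 = 2 :> R); last by rewrite expr2; lra.
    have : 0 <= 2^-1 ^+ k :> R by rewrite exprn_ge0// invr_ge0.
    by rewrite exprS; lra.
  have : nrm (inner (y k) (X m)) <=
      nrm (inner (y k) (X m.+1)) + nrm ((c m)%:C *: inner (y k) (y m)).
    by rewrite XS -{1}(addrK ((c m)%:C *: inner (y k) (y m)) (inner _ _)) nrmB.
  rewrite nrmZ ger0_norm//.
  have := IH km; have := ch m; have := c0 m.
  have := yy m k; rewrite neq_ltn km orbT => /(_ isT).
  by have := nrm_ge0 (inner (y k) (y m)); rewrite exprS; nra.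
(* In the limit the inner product of [y k] with [x] is at least [2 ^+ k - 2], yet it is bounded by
   [tau (y k) * al x <= al x], independently of [k]. *)
have main k : 2 ^+ k - 2 <= al x.
  have k4 : 0 < 4 ^+ k :> R by rewrite exprn_gt0.
  apply/ler_addgt0Pl => e e0; have [N NP] := Xx _ (divr_gt0 e0 k4).
  pose m := maxn N k.+1.
  have := hi k m (leq_maxr _ _).
  have := NP m (leq_maxl _ _); rewrite ltr_pdivlMr// => Xe.
  have : nrm (inner (y k) (X m)) <= nrm (inner (y k) (X m - x)) + nrm (inner (y k) x).
    by rewrite -{1}(subrK x (X m)) innerDr ?nrmD//; exact: ell2B.
  have := nrm_inner (yl k) (ell2B (Xl m) xl); rewrite yn.
  have := xal _ (yl k).
  have : tau (y k) * al x <= al x.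
    apply: ler_piMl => //; apply: le_trans (yt k) _.
    by rewrite invf_le1 ?ltr_pwDl// lerDl.
  have : 0 <= 2^-1 ^+ m :> R by rewrite exprn_ge0// invr_ge0.
  lra.
have h k : k%:R <= 2 ^+ k :> R by rewrite -natrX ler_nat ltnW// ltn_expl.
have := main (Num.Def.truncn (al x + 2)).+1.
have := h (Num.Def.truncn (al x + 2)).+1.
have := truncnS_gt (al x + 2).
lra.
Qed.

Definition frame x : sequ A := \sum_i (inner (p i) x : A^c) *: p i.

Lemma frame_in x : cs_set P (frame x).
Proof. by apply: cs_sum => i; exact: csZ. Qed.

Lemma frame_linear (a : A^c) x y : ell2 x -> ell2 y ->
  frame (a *: x + y) = a *: frame x + frame y.
Proof.
move=> xl yl; rewrite /frame scaler_sumr -big_split; apply: eq_bigr => i _ /=.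
by rewrite innerDr//; [rewrite innerZr// scalerA -scalerDl|exact: ell2Z].
Qed.

Lemma frameD x y : ell2 x -> ell2 y -> frame (x + y) = frame x + frame y.
Proof. by move=> xl yl; rewrite -[x]scale1r frame_linear// !scale1r. Qed.

Lemma frame_bounded : exists2 K : R, 0 <= K &
  forall x, ell2 x -> hn (frame x) <= K * hn x.
Proof.
exists (\sum_i hn (p i) * hn (p i)).
  by apply: sumr_ge0 => i _; rewrite mulr_ge0 ?hn_ge0.
move=> x xl; rewrite mulr_suml.
have [] : ell2 (frame x) /\
    hn (frame x) <= \sum_i hn (p i) * hn (p i) * hn x; last by [].
apply: (big_ind2 (fun y t => ell2 y /\ hn y <= t)).
- by rewrite hn0; split => //; exact: ell2_0.
- move=> y t z u [yl yt] [zl zu]; split; first exact: ell2D.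
  by apply: le_trans (hnD yl zl) _; rewrite lerD.
- move=> i _; split; first exact: ell2Z.
  apply: le_trans (hnZ (inner (p i) x : A^c) (@pl i)) _.
  rewrite -mulrA ler_wpM2l ?hn_ge0//.
  exact: nrm_inner.
Qed.

Lemma frame_inner x : ell2 x ->
  inner (frame x) x = \sum_i star (inner (p i) x) * inner (p i) x.
Proof.
move=> xl.
have fl i : ell2 ((inner (p i) x : A^c) *: p i) by exact: ell2Z.
have [_ ->] := inner_suml fl xl.
by apply: eq_bigr => i _; rewrite innerZl.
Qed.

(** Each square of an [inner (p i) x] is one summand of a sum of positive elements, so its norm is
    at most that of the sum; adding up the [n] roots gives the factor [n]. *)
Lemma tau_le_frame x : ell2 x -> tau x ^+ 2 <= n%:R ^+ 2 * nrm (inner (frame x) x).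
Proof.
move=> xl; set N := nrm _.
have le i : nrm (inner (p i) x) <= Num.sqrt N.
  apply: le_of_sqr; first exact: sqrtr_ge0.
  rewrite sqr_sqrtr ?nrm_ge0// -nrm_starM /N frame_inner// (bigD1 i)//=.
  apply: pos_nrm_le; first exact: pos_starM.
  apply: (big_ind (@pos R A)) => [|a b|j _]; [exact: pos0|exact: posD|].
  exact: pos_starM.
rewrite -[N]sqr_sqrtr ?nrm_ge0// -exprMn lerXn2r ?nnegrE ?tau_ge0//.
  by rewrite mulr_ge0 ?sqrtr_ge0.
apply: le_trans (ler_sum _ (fun i _ => le i)) _.
by rewrite sumr_const card_ord mulr_natl.
Qed.

(** The shift adds [t <x, x>] to [<frame x, x>]; both are positive, so the norm does not decrease
    and the bound is uniform in [t]. For [y = t x + frame x], [d ^+ 2 * hn x ^+ 2] is then at most a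
    constant times [nrm (inner y x)], and Cauchy-Schwarz allows one factor [hn x] to be
    cancelled. *)
Lemma frame_shift_below : exists2 g : R, 0 < g & forall t x, 0 <= t ->
  cs_set P x -> g * hn x <= hn (rs A t *: x + frame x).
Proof.
have [d d0 dP] := tau_bounded_below.
(* The summand 1 keeps the divisor positive when the family of generators is empty. *)
pose n1 : R := n%:R ^+ 2 + 1.
have n10 : 0 < n1 by rewrite /n1 ltr_wpDl ?exprn_ge0.
exists (d ^+ 2 / n1); first by rewrite divr_gt0 ?exprn_gt0.
move=> t x t0 xP; have xl := cs_sub xP; have fl := cs_sub (frame_in x).
have tl : ell2 (rs A t *: x) by exact: ell2Z.
set y := _ + _; have yl : ell2 y by exact: ell2D.
have h1 : nrm (inner (frame x) x) <= nrm (inner y x).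
  rewrite /y innerDl// innerZl// /rs star_scale star1 -cstar_scaleAl mul1r addrC.
  (* Monotonicity is applied to the partial sums of [inner x x], which are known to be positive, and
     the inequality then passes to the limit. *)
  apply: tends_nrm_ge (tendsD (tends_cst (inner (frame x) x))
    (tendsZ t%:C (inner_tends xl xl))) _.
  apply: nearW => k; apply: pos_nrm_le; last by apply: posZ => //; exact: bip_pos.
  rewrite frame_inner//; apply: pos_sum => i; exact: pos_starM.
have h2 := tau_le_frame xl; have h3 := nrm_inner yl xl.
have h4 : (d * hn x) ^+ 2 <= n1 * (hn y * hn x).
  have : (d * hn x) ^+ 2 <= tau x ^+ 2.
    by rewrite lerXn2r ?nnegrE ?tau_ge0 ?dP// mulr_ge0 ?hn_ge0// ltW.
  move/le_trans; apply; apply: le_trans h2 _; apply: ler_pM => //.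
  - by rewrite exprn_ge0.
  - exact: nrm_ge0.
  - by rewrite lerDl.
  - exact: le_trans h1 h3.
rewrite mulrAC ler_pdivrMr//.
have [x0|x0] := eqVneq (hn x) 0.
  by rewrite x0 mulr0 mulr_ge0 ?hn_ge0// ltW.
have xp : 0 < hn x by rewrite lt_neqAle hn_ge0 eq_sym x0.
rewrite -(ler_pM2r xp); move: h4; rewrite exprMn !expr2; lra.
Qed.

(* [rs A t *: x + frame x] is surjective in [x] for large [t], and surjectivity
   propagates down to [t = 0] in equal steps since the lower bound is uniform
   in [t]. *)
Lemma frame_surjective y : cs_set P y -> exists2 x, cs_set P x & frame x = y.
Proof.
have [g g0 gP] := frame_shift_below; have [K K0 KP] := frame_bounded.
pose L t x := rs A t *: x + frame x.
have rsD t u : rs A (t + u) = rs A t + rs A u by rewrite /rs -scaleRD.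
have LP t x : cs_set P x -> cs_set P (L t x).
  by move=> xP; apply: csD; [exact: csZ|exact: frame_in].
have LD t x z : cs_set P x -> cs_set P z -> L t (x + z) = L t x + L t z.
  by move=> /cs_sub xl /cs_sub zl; rewrite /L frameD// scalerDr addrACA.
have LC t x : cs_set P x -> hn (L t x) <= (`|t| + K) * hn x.
  move=> xP; have xl := cs_sub xP; rewrite mulrDl -hn_rs//.
  apply: le_trans (hnD _ (cs_sub (frame_in x))) _; first exact: ell2Z.
  by rewrite lerD2l KP.
(* From [K <= T / 2] the frame operator is an admissible perturbation of the multiplication by
   [T]. *)
pose T := 2 * K + 1; have T0 : 0 < T by rewrite /T; lra.
have sT z : cs_set P z -> exists2 x, cs_set P x & L T x = z.
  move=> zP; have [||||||||x xP <-] := @perturb_surjective _ _ P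
    (fun x => rs A T *: x) (fun x => - frame x) T (`|T| + K) T0 _ _ _ _ _ _ _ _ z zP.
  - by move=> x xP; apply: csN; exact: frame_in.
  - by move=> x w xP wP; rewrite scalerDr.
  - by move=> x w /cs_sub xl /cs_sub wl; rewrite frameD// opprD.
  - by move=> x xP; rewrite opprK; exact: LC.
  - by move=> x /cs_sub xl; rewrite hn_rs// gtr0_norm.
  - move=> x /cs_sub xl; rewrite hnN; apply: le_trans (KP _ xl) _.
    by rewrite ler_wpM2r ?hn_ge0// /T; lra.
  - by move=> x xP; exact: csZ.
  - move=> w wP; exists (rs A T^-1 *: w); first exact: csZ.
    by rewrite scalerA rsM mulfV ?lt0r_neq0// /rs scaleR1 scale1r.
  - by exists x; rewrite // opprK.
(* The number of equal steps from [T] to 0 that makes the step length [h] at most [g / 2]. *)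
pose M := (Num.Def.truncn (2 * T / g)).+1.
have M0 : 0 < M%:R :> R by rewrite ltr0n.
pose h := T / M%:R; have h0 : 0 < h by rewrite divr_gt0.
have hg : h <= g / 2.
  rewrite ler_pdivrMr//; have := truncnS_gt (2 * T / g).
  by rewrite -/M ltr_pdivrMr//; lra.
have step k : (k <= M)%N -> forall z, cs_set P z ->
    exists2 x, cs_set P x & L (T - k%:R * h) x = z.
  elim: k => [|k IH] kM z zP; first by rewrite mul0r subr0; exact: sT.
  have tk : 0 <= T - k%:R * h.
    rewrite subr_ge0 /h mulrCA; apply: ler_piMr; first exact: ltW.
    rewrite ler_pdivrMr// mul1r ler_nat.
    exact: ltnW.
  have LE x : L (T - k%:R * h) x - rs A h *: x = L (T - k.+1%:R * h) x.
    rewrite /L addrAC; congr (_ + _); apply/eqP; rewrite subr_eq -scalerDl -rsD.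
    by apply/eqP; congr (rs _ _ *: _); rewrite -natr1; lra.
  have [||||||||x xP xz] := @perturb_surjective _ _ P
    (L (T - k%:R * h)) (fun x => rs A h *: x) g
    (`|T - k.+1%:R * h| + K) g0 _ _ _ _ _ _ _ _ z zP.
  - by move=> x xP; exact: csZ.
  - exact: LD.
  - by move=> x w xP wP; rewrite scalerDr.
  - by move=> x xP; rewrite LE; exact: LC.
  - by move=> x xP; exact: gP.
  - by move=> x /cs_sub xl; rewrite hn_rs// gtr0_norm// ler_wpM2r ?hn_ge0.
  - exact: LP.
  - exact: IH (ltnW kM).
  - by exists x; rewrite // -LE.
move=> yP; have [x xP <-] := step M (leqnn M) y yP; exists x => //.
rewrite /L /h mulrCA mulfV ?lt0r_neq0// mulr1 subrr.
by rewrite /rs scale0r scale0r add0r.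
Qed.

Lemma frame_below : exists2 g : R, 0 < g &
  forall x, cs_set P x -> g * hn x <= hn (frame x).
Proof.
have [g g0 gP] := frame_shift_below; exists g => // x xP.
by have := gP 0 x (lexx 0) xP; rewrite /rs !scale0r add0r.
Qed.

Lemma frame_inj x y : cs_set P x -> cs_set P y -> frame x = frame y -> x = y.
Proof.
move=> xP yP xy; have [g g0 gP] := frame_below.
have dP := csB xP yP; apply/eqP; rewrite -subr_eq0; apply/eqP.
apply: (hn_eq0 (cs_sub dP)); apply/eqP; rewrite eq_le hn_ge0 andbT.
rewrite -(pmulr_rle0 _ g0); apply: le_trans (gP _ dP) _.
have xl := cs_sub xP; have yl := cs_sub yP.
by rewrite addrC -scaleN1r frame_linear// xy scaleN1r addNr hn0.
Qed.

End FrameOperator.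

(** * The index *)

Section FredholmIndex.
Variable B : pzRingType.
Implicit Types H N : lmodType B.

Lemma lmod_iso_bij N N' (f : N -> N') : linear f -> injective f ->
  (forall y, exists x, f x = y) -> lmod_iso N N'.
Proof.
move=> fl fi /boolp.choice[g gK]; apply: (lmod_isoI fl (g := g)) => // x.
by apply: fi; rewrite gK.
Qed.

(* A homotopy equivalence, given by [i], [p] and the homotopy [h], between the
   complex [F : H -> H] and the complex [d : N1 -> N2]. *)
Record reduction H N1 N2 (F : H -> H) := Reduction {
  red_i1 : {linear N1 -> H}; red_p1 : {linear H -> N1};
  red_i2 : {linear N2 -> H}; red_p2 : {linear H -> N2};
  red_h : {linear H -> H}; red_d : {linear N1 -> N2};
  red_pi1 : cancel red_i1 red_p1;
  red_pi2 : cancel red_i2 red_p2;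
  red_hF : forall x, red_h (F x) + red_i1 (red_p1 x) = x;
  red_Fh : forall x, F (red_h x) + red_i2 (red_p2 x) = x;
  red_Fi : forall x, F (red_i1 x) = red_i2 (red_d x);
  red_pF : forall x, red_p2 (F x) = red_d (red_p1 x)
}.

Section Comparison.
Variables (H : lmodType B) (F : H -> H) (N1 N2 N1' N2' : lmodType B).
Variables (r : reduction N1 N2 F) (r' : reduction N1' N2' F).

(** The comparison [N1 -> N1' -> N1] through [H] is the identity up to a homotopy, namely that of
    [r'] transported to [r]. *)
Lemma comparison_homotopy1 n :
  red_p1 r (red_h r' (red_i2 r (red_d r n))) +
  red_p1 r (red_i1 r' (red_p1 r' (red_i1 r n))) = n.
Proof. by rewrite -linearD -red_Fi red_hF red_pi1. Qed.

Lemma comparison_homotopy2 w :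
  red_d r (red_p1 r (red_h r' (red_i2 r w))) +
  red_p2 r (red_i2 r' (red_p2 r' (red_i2 r w))) = w.
Proof. by rewrite -red_pF -linearD red_Fh red_pi2. Qed.

Lemma comparison_chain n :
  red_p2 r' (red_i2 r (red_d r n)) = red_d r' (red_p1 r' (red_i1 r n)).
Proof. by rewrite -red_Fi red_pF. Qed.

End Comparison.

(* The contractible mapping cone of the comparison [N -> N'] splits as
   [dsum N1 N2' -> dsum N2 N1']. *)
Theorem index_well_defined H N1 N2 N1' N2' (F : H -> H) :
  reduction N1 N2 F -> reduction N1' N2' F ->
  lmod_iso (dsum N1 N2') (dsum N2 N1').
Proof.
move=> r r'.
pose phi1 n := red_p1 r' (red_i1 r n); pose phi2 n := red_p2 r' (red_i2 r n).
pose psi1 n := red_p1 r (red_i1 r' n); pose psi2 n := red_p2 r (red_i2 r' n).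
pose s w := red_p1 r (red_h r' (red_i2 r w)).
pose s' w := red_p1 r' (red_h r (red_i2 r' w)).
(* The differentials of the cone are [n |-> (d n, phi1 n)] and [(y, z) |-> phi2 y - d' z]. The
   columns of [f] are the first differential and the section [w |-> (psi2 w, - s' w)] of the second
   one. *)
pose f (x : dsum N1 N2') : dsum N2 N1' :=
  (red_d r x.1 + psi2 x.2, phi1 x.1 - s' x.2).
have fl : linear f.
  move=> a [n w] [m v]; rewrite /f /psi2 /phi1 /s' /=; congr (_, _) => /=.
    by rewrite !linearP scalerDr addrACA.
  by rewrite !linearP /= scalerDr addrACA.
apply: (lmod_iso_bij fl).
  suff f0 x : f x = 0 -> x = 0.
    move=> x y fxy; apply/eqP; rewrite -subr_eq0; apply/eqP/f0.
    by rewrite addrC -scaleN1r fl fxy scaleN1r addNr.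
  case: x => n w; rewrite /f /= => -[dn pn].
  have pn' : phi1 n = s' w by apply/eqP; rewrite -subr_eq0; apply/eqP.
  have w0 : w = 0.
    rewrite -(comparison_homotopy2 r' r w) -/(s' w) -pn' -comparison_chain.
    by rewrite -/(psi2 w) -linearD /= -linearD dn !linear0.
  move: dn pn'; rewrite w0 /psi2 /s' !linear0 addr0 => dn pn'.
  congr (_, _); rewrite -(comparison_homotopy1 r r' n) dn -/(phi1 n) pn'.
  by rewrite !linear0 addr0.
(* The pair [(s y, phi2 y)] is mapped to [(y, k)], and [(psi1 z', - d' z')] to [(0, z')]; their sum
   is the required preimage. *)
move=> [y z]; pose k := phi1 (s y) - s' (phi2 y); pose z' := z - k.
exists (s y + psi1 z', phi2 y - red_d r' z').
rewrite /f /=; congr (_, _).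
  rewrite linearD /= {1}/psi2 linearB linearB /= -/(psi2 _) -/(psi2 _).
  rewrite /psi2 comparison_chain -/(psi1 z') addrACA subrr addr0.
  exact: comparison_homotopy2.
have phiD a b : phi1 (a + b) = phi1 a + phi1 b by rewrite /phi1 !linearD.
have sB a b : s' (a - b) = s' a - s' b by rewrite /s' !linearB.
rewrite phiD sB opprB (addrC (s' _)) addrACA -/k (addrC (phi1 _)).
by rewrite comparison_homotopy1 addrC subrK.
Qed.

End FredholmIndex.

(** * Maps between closed submodules, retractions, and reductions from Fredholm decompositions *)

Section ClosedSubmoduleMaps.
Variables (R : realType) (A : unitalCstarType R).
Implicit Types (M N P : closed_submodule A) (x y z : sequ A).

Definition cs_elt M x (xM : cs_set M x) : cs_type M := CsType (asboolT xM).

Lemma cs_eltP M (u : cs_type M) : cs_set M u.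
Proof. exact: (asboolW (cs_valP u)). Qed.

Lemma cs_val_inj M (u v : cs_type M) : u = v :> sequ A -> u = v.
Proof. exact: val_inj. Qed.

Lemma cs_valD M (u v : cs_type M) :
  (u + v : cs_type M) = (u : sequ A) + (v : sequ A) :> sequ A.
Proof. by []. Qed.

Lemma cs_val_linear M (a : A^c) (u v : cs_type M) :
  (a *: u + v : cs_type M) = a *: (u : sequ A) + (v : sequ A) :> sequ A.
Proof. by []. Qed.

Lemma cs_val_sum M n (f : 'I_n -> cs_type M) :
  (\sum_i f i : cs_type M) = \sum_i (f i : sequ A) :> sequ A.
Proof. exact: (big_morph (@cs_val _ _ M)). Qed.

(** Maps are handled as functions on all sequences with properties relative to a submodule, so that
    they compose without coercions; [cs_map] and [cs_unmap] translate to and from linear maps of the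
    subtypes. *)
Definition linear_on M (f : sequ A -> sequ A) :=
  forall (a : A^c) x y, cs_set M x -> cs_set M y -> f (a *: x + y) = a *: f x + f y.

Definition bounded_on M (f : sequ A -> sequ A) :=
  exists C : R, forall x, cs_set M x -> hn (f x) <= C * hn x.

Lemma linear_onD M f x y : linear_on M f -> cs_set M x -> cs_set M y ->
  f (x + y) = f x + f y.
Proof. by move=> fl xM yM; rewrite -[x]scale1r fl// !scale1r. Qed.

Lemma linear_onB M f x y : linear_on M f -> cs_set M x -> cs_set M y ->
  f (x - y) = f x - f y.
Proof. by move=> fl xM yM; rewrite addrC -scaleN1r fl// scaleN1r addrC. Qed.

Lemma linear_on0 M f : linear_on M f -> f 0 = 0.
Proof. by move=> fl; rewrite -(subrr 0) (linear_onB fl) ?subrr//; exact: cs_zero. Qed.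

Lemma cs_map M N f : (forall x, cs_set M x -> cs_set N (f x)) -> linear_on M f ->
  exists g : {linear cs_type M -> cs_type N}, forall u, g u = f u :> sequ A.
Proof.
move=> fN fl; pose g (u : cs_type M) : cs_type N := cs_elt (fN _ (cs_eltP u)).
have gl : linear g.
  by move=> a u v; apply: cs_val_inj; exact: (fl a _ _ (cs_eltP u) (cs_eltP v)).
pose G : {linear cs_type M -> cs_type N} :=
  HB.pack g (GRing.isLinear.Build _ _ _ _ g gl).
by exists G.
Qed.

Lemma cs_unmap M N (g : {linear cs_type M -> cs_type N}) : exists f,
  [/\ forall x, cs_set M x -> cs_set N (f x), linear_on M f,
      (forall u, g u = f u :> sequ A) & bounded_map g -> bounded_on M f].
Proof.
(* Extension by the default value 0 outside [M]. *)
pose f x := if pselect (cs_set M x) is left xM then cs_val (g (cs_elt xM)) else 0.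
have fE (u : cs_type M) : f u = g u.
  rewrite /f; case: pselect => [uM|]; last by move/(_ (cs_eltP u)).
  by congr (cs_val (g _)); exact: cs_val_inj.
have fE' x (xM : cs_set M x) : f x = g (cs_elt xM) by rewrite -fE.
exists f; split=> //.
- by move=> x xM; rewrite fE'; exact: cs_eltP.
- move=> a x y xM yM; rewrite (fE' x) (fE' y).
  by rewrite -cs_val_linear -linearP -fE.
(* The order of [R[i]] compares real parts and [hnorm] is real, so the real part of [k] is a bound
   too. *)
- move=> [k kP]; exists (complex.Re k) => x xM.
  have := kP (cs_elt xM); rewrite !hnormE -fE.
  case: k {kP} => k1 k2; rewrite lecE /= => /andP[_].
  by rewrite mulr0 subr0.
Qed.

Lemma hiso_intro M N f g : (forall x, cs_set M x -> cs_set N (f x)) ->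
  (forall y, cs_set N y -> cs_set M (g y)) -> linear_on M f -> linear_on N g ->
  (forall x, cs_set M x -> g (f x) = x) -> (forall y, cs_set N y -> f (g y) = y) ->
  bounded_on M f -> bounded_on N g -> hiso M N.
Proof.
move=> fN gM fl gl fK gK [C fC] [D gD].
have [f' f'E] := cs_map fN fl; have [g' g'E] := cs_map gM gl.
exists f'; split.
  exists C%:C => u; rewrite !hnormE f'E -rmorphM lecR.
  by apply: fC; exact: cs_eltP.
exists g'; split.
- by move=> u; apply: cs_val_inj; rewrite g'E f'E fK//; exact: cs_eltP.
- by move=> u; apply: cs_val_inj; rewrite f'E g'E gK//; exact: cs_eltP.
- exists D%:C => u; rewrite !hnormE g'E -rmorphM lecR.
  by apply: gD; exact: cs_eltP.
Qed.

Lemma hiso_elim M N : hiso M N -> exists f g,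
  [/\ (forall x, cs_set M x -> cs_set N (f x)) /\
      (forall y, cs_set N y -> cs_set M (g y)), linear_on M f /\ linear_on N g,
      forall x, cs_set M x -> g (f x) = x, forall y, cs_set N y -> f (g y) = y &
      bounded_on M f /\ bounded_on N g].
Proof.
move=> [f' [fb [g' [fK gK gb]]]].
have [f [fN fl fE fB]] := cs_unmap f'; have [g [gM gl gE gB]] := cs_unmap g'.
exists f, g; split=> //; last by split; [exact: fB|exact: gB].
- move=> x xM; have -> : f x = f' (cs_elt xM) by rewrite fE.
  by rewrite -gE fK.
- move=> x xM; have -> : g x = g' (cs_elt xM) by rewrite gE.
  by rewrite -fE gK.
Qed.

Lemma hiso_lmod_iso M N : hiso M N -> lmod_iso (cs_type M) (cs_type N).
Proof. by move=> [f [_ [g [fK gK _]]]]; exists f; exists g. Qed.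

Section MkClosed.
Variable S : set (sequ A).
Hypothesis S_sub : S `<=` @ell2 R A.
Hypothesis S_zero : S 0.
Hypothesis S_lin : forall (a : A^c) x y, S x -> S y -> S (a *: x + y).
Hypothesis S_closed : forall x, ell2 x ->
  (forall e : R, 0 < e -> exists2 y, S y & hn (x - y) < e) -> S x.

Lemma mk_closed_subproof x : ell2 x ->
  (forall e : R[i], 0 < e -> exists2 y, S y & hnorm (x - y) < e) -> S x.
Proof.
move=> xl xS; apply: S_closed => // e e0.
by have [|y yS xy] := xS e%:C; [rewrite ltcR|exists y; rewrite // -ltcR -hnormE].
Qed.

Definition mk_closed : closed_submodule A :=
  ClosedSubmodule S_sub S_zero S_lin mk_closed_subproof.

End MkClosed.

(** [H_A] as a submodule of itself, so that operators become endomorphisms of a [cs_type]. It is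
    transparent so that membership unfolds to [ell2]. *)
Definition cs_full : closed_submodule A.
Proof.
apply: (@mk_closed (@ell2 R A)) => //; first exact: ell2_0.
by move=> a x y xl yl; apply: ell2D => //; exact: ell2Z.
Defined.

Lemma cs_fg_generators P : cs_fg P -> exists n (p : 'I_n -> sequ A),
  (forall i, cs_set P (p i)) /\
  forall x, cs_set P x -> exists a : 'I_n -> A^c, x = \sum_i a i *: p i.
Proof.
move=> [n [g gP]]; exists n, (fun i => g i : sequ A); split=> [i|x xP].
  exact: cs_eltP.
have [a xa] := gP (cs_elt xP); exists a.
by have := congr1 (@cs_val _ _ P) xa; rewrite cs_val_sum.
Qed.

Lemma frame_inverse P n (p : 'I_n -> sequ A) : (forall i, cs_set P (p i)) ->
  (forall x, cs_set P x -> exists a : 'I_n -> A^c, x = \sum_i a i *: p i) ->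
  exists G, [/\ forall y, cs_set P y -> cs_set P (G y),
    forall y, cs_set P y -> frame p (G y) = y,
    forall x, cs_set P x -> G (frame p x) = x,
    linear_on P G & bounded_on P G].
Proof.
move=> pP pG.
have /boolp.choice[G GE] : forall y, exists x,
    cs_set P y -> cs_set P x /\ frame p x = y.
  move=> y; have [/(frame_surjective pP pG)[x xP xy]|yP] := pselect (cs_set P y).
    by exists x.
  by exists 0.
have GP y : cs_set P y -> cs_set P (G y) by move=> /GE[].
have GK y : cs_set P y -> frame p (G y) = y by move=> /GE[].
exists G; split=> //.
- move=> x xP; have fP := frame_in pP x.
  by apply: (frame_inj pP pG); [exact: GP|exact: xP|exact: GK].
- move=> a x y xP yP; apply: (frame_inj pP pG).
  + by apply: GP; exact: cs_lin.
  + by apply: cs_lin; exact: GP.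
  + rewrite (frame_linear pP) ?GK//; first exact: cs_lin.
    * exact: cs_sub (GP _ xP).
    * exact: cs_sub (GP _ yP).
- have [g g0 gP] := frame_below pP pG; exists g^-1 => y yP.
  by have := gP _ (GP _ yP); rewrite GK// ler_pdivlMl.
Qed.

(** The frame operator is defined on all of [ell2] with values in [P]; following it by its inverse
    on [P] gives a map that restricts to the identity there. *)
Theorem fg_retraction P : cs_fg P -> exists r,
  [/\ forall x, ell2 x -> cs_set P (r x), forall x, cs_set P x -> r x = x,
      linear_on cs_full r & bounded_on cs_full r].
Proof.
move=> /cs_fg_generators[n [p [pP pG]]].
have [G [GP GK KG Gl [C GC]]] := frame_inverse pP pG.
have fP := frame_in pP.
exists (G \o frame p); split=> /=.
- by move=> x _; exact: GP.
- exact: KG.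
- by move=> a x y xl yl; rewrite /= (frame_linear pP)// Gl.
- have [K K0 KP] := frame_bounded pP; exists (`|C| * K) => x xl /=.
  apply: le_trans (GC _ (fP _)) _; rewrite -mulrA.
  apply: le_trans (ler_wpM2r (hn_ge0 _) (ler_norm _)) _.
  by rewrite ler_wpM2l// KP.
Qed.

(** The formula [x = \sum_i p_i <p_i, G x>] is a dual basis: its coefficients are linear in [x], so
    it suffices to lift the images of the generators. *)
Theorem fg_projective P : cs_fg P -> projective (cs_type P).
Proof.
move=> /cs_fg_generators[n [p [pP pG]]].
have [G [GP GK KG Gl _]] := frame_inverse pP pG.
move=> U V q f qs.
have /boolp.choice[u uE] : forall i, exists u, q u = f (cs_elt (pP i)).
  by move=> i; exact: qs.
pose h (x : cs_type P) := \sum_i (inner (p i) (G x) : A^c) *: u i.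
have hl : linear h.
  move=> a x y; rewrite /h scaler_sumr -big_split; apply: eq_bigr => i _ /=.
  have [xP yP] := (cs_eltP x, cs_eltP y).
  have [xl yl] := (cs_sub (GP _ xP), cs_sub (GP _ yP)).
  have pl := cs_sub (pP i).
  rewrite (Gl a x y xP yP) innerDr//; last exact: ell2Z.
  by rewrite innerZr// scalerA -scalerDl.
pose H : {linear cs_type P -> U} := HB.pack h (GRing.isLinear.Build _ _ _ _ h hl).
exists H => x; rewrite /= /h linear_sum.
under eq_bigr do rewrite linearZ /= uE -linearZ.
rewrite -linear_sum; congr (f _); apply: cs_val_inj; rewrite cs_val_sum.
exact: (GK _ (cs_eltP x)).
Qed.

Lemma direct_sum_projections M N : direct_sum M N -> exists f g,
  [/\ forall x, ell2 x -> cs_set M (f x), forall x, ell2 x -> cs_set N (g x),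
      forall x, ell2 x -> f x + g x = x,
      forall x y, cs_set M x -> cs_set N y -> f (x + y) = x /\ g (x + y) = y &
      linear_on cs_full f /\ linear_on cs_full g].
Proof.
move=> [MN MN0].
have /boolp.choice[fg fgE] : forall x, exists yz : sequ A * sequ A,
    ell2 x -> [/\ cs_set M yz.1, cs_set N yz.2 & x = yz.1 + yz.2].
  move=> x; have [/MN[y [z yz]]|xl] := pselect (ell2 x); first by exists (y, z).
  by exists (0, 0).
have uniq x y x' y' : cs_set M x -> cs_set N y -> cs_set M x' -> cs_set N y' ->
    x + y = x' + y' -> x = x' /\ y = y'.
  move=> xM yN xM' yN' e.
  have xx : x - x' = y' - y.
    by apply/eqP; rewrite subr_eq addrAC -subr_eq opprK e addrC.
  have x0 : x - x' = 0 by apply: MN0; [|rewrite xx]; exact: csB.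
  split; apply/eqP; rewrite -subr_eq0; first by rewrite x0.
  by rewrite -opprB -xx x0 oppr0.
have fgu x y : cs_set M x -> cs_set N y -> (fg (x + y)).1 = x /\ (fg (x + y)).2 = y.
  move=> xM yN; have xyl := ell2D (cs_sub xM) (cs_sub yN).
  by have [uM vN e] := fgE _ xyl; apply: uniq.
have fgl (a : A^c) x y : ell2 x -> ell2 y ->
    (fg (a *: x + y)).1 = a *: (fg x).1 + (fg y).1 /\
    (fg (a *: x + y)).2 = a *: (fg x).2 + (fg y).2.
  move=> /fgE[xM xN xE] /fgE[yM yN yE].
  have -> : a *: x + y =
      (a *: (fg x).1 + (fg y).1) + (a *: (fg x).2 + (fg y).2).
    by rewrite addrACA -scalerDr -xE -yE.
  by apply: fgu; apply: cs_lin.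
exists (fun x => (fg x).1), (fun x => (fg x).2); split=> //.
- by move=> x /fgE[].
- by move=> x /fgE[].
- by move=> x /fgE[_ _ <-].
- by split=> a x y xl yl; have [] := fgl a x y xl yl.
Qed.

(** The homotopy projects onto [M2] and then applies the inverse of [M1 -> M2]; as [F] is diagonal
    it commutes with the projections, so this is inverse to [F] up to the projections on [N1] and
    [N2]. *)
Lemma fredholm_reduction F M1 N1 M2 N2 : adjointable F ->
  fredholm_decomposition F M1 N1 M2 N2 ->
  forall Ff : cs_type cs_full -> cs_type cs_full,
  (forall u, Ff u = F u :> sequ A) ->
  inhabited (reduction (cs_type N1) (cs_type N2) Ff).
Proof.
move=> [Fl FL _ _] [[D1 D2] [f' [[_ [g' [fK gK _]]] fE]] FN _] Ff FfE.
have [m1 [n1 [m1M n1N mn1 mn1u [m1l n1l]]]] := direct_sum_projections D1.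
have [m2 [n2 [m2M n2N mn2 mn2u [m2l n2l]]]] := direct_sum_projections D2.
have [h [hM hl hE _]] := cs_unmap g'.
have FM x : cs_set M1 x -> cs_set M2 (F x).
  by move=> xM; have := cs_eltP (f' (cs_elt xM)); rewrite fE.
have Fh y : cs_set M2 y -> F (h y) = y.
  move=> yM; have -> : h y = g' (cs_elt yM) by rewrite hE.
  by rewrite -fE gK.
have hF x : cs_set M1 x -> h (F x) = x.
  move=> xM; have -> : F x = f' (cs_elt xM) by rewrite fE.
  by rewrite -hE fK.
have F2 x : ell2 x -> m2 (F x) = F (m1 x) /\ n2 (F x) = F (n1 x).
  move=> xl; have xE : F x = F (m1 x) + F (n1 x).
    rewrite -{1}(mn1 _ xl) -[m1 x]scale1r FL ?scale1r//.
      exact: cs_sub (m1M _ xl).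
    exact: cs_sub (n1N _ xl).
  by rewrite xE; apply: mn2u; [exact/FM/m1M|exact/FN/n1N].
have id_l M : linear_on M id by [].
have [|i1 i1E] := @cs_map N1 cs_full id _ (id_l _); first exact: cs_sub.
have [|i2 i2E] := @cs_map N2 cs_full id _ (id_l _); first exact: cs_sub.
have [p1 p1E] := @cs_map cs_full N1 n1 n1N n1l.
have [p2 p2E] := @cs_map cs_full N2 n2 n2N n2l.
have [||H HE] := @cs_map cs_full cs_full (h \o m2).
- by move=> x xl; apply: cs_sub (hM _ (m2M _ xl)).
- by move=> a x y xl yl /=; rewrite m2l// hl//; exact: m2M.
have [|d dE] := @cs_map N1 N2 F FN.
  by move=> a x y /cs_sub xl /cs_sub yl; exact: FL.
constructor; apply: (@Reduction _ _ _ _ _ i1 p1 i2 p2 H d).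
- move=> u; apply: cs_val_inj; rewrite p1E i1E.
  by have [_] := mn1u 0 u (cs_zero _) (cs_eltP u); rewrite add0r.
- move=> u; apply: cs_val_inj; rewrite p2E i2E.
  by have [_] := mn2u 0 u (cs_zero _) (cs_eltP u); rewrite add0r.
- move=> u; apply: cs_val_inj; have ul : ell2 u := cs_eltP u.
  rewrite cs_valD HE FfE i1E p1E /=; have [-> _] := F2 u ul.
  by rewrite hF ?mn1//; exact: m1M.
- move=> u; apply: cs_val_inj; have ul : ell2 u := cs_eltP u.
  by rewrite cs_valD FfE HE i2E p2E /= Fh ?mn2//; exact: m2M.
- by move=> u; apply: cs_val_inj; rewrite FfE i1E i2E dE.
- move=> u; apply: cs_val_inj; rewrite p2E FfE dE p1E.
  by have [_ ->] := F2 u (cs_eltP u).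
Qed.

Lemma fredholm_index F M1 N1 M2 N2 M1' N1' M2' N2' : adjointable F ->
  fredholm_decomposition F M1 N1 M2 N2 ->
  fredholm_decomposition F M1' N1' M2' N2' ->
  lmod_iso (dsum (cs_type N1) (cs_type N2')) (dsum (cs_type N2) (cs_type N1')).
Proof.
move=> FA D D'; have [Fl FL _ _] := FA.
have [|Ff FfE] := @cs_map cs_full cs_full F Fl; first exact: FL.
have [r] := fredholm_reduction FA D FfE.
have [r'] := fredholm_reduction FA D' FfE.
exact: index_well_defined r r'.
Qed.

End ClosedSubmoduleMaps.

(** * Comparison of submodules *)

Section Interleaving.
Variables (R : realType) (A : unitalCstarType R).
Implicit Types (x y z : sequ A).

(** Even and odd coordinates identify [H_A] with two copies of itself, which makes room for external
    direct sums. *)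
Definition evens z : sequ A := fun i => z i.*2.
Definition odds z : sequ A := fun i => z i.*2.+1.
Definition interleave x y : sequ A := fun i => if odd i then y i./2 else x i./2.

Lemma evensK x y : evens (interleave x y) = x.
Proof. by apply/funext => i; rewrite /evens /interleave odd_double doubleK. Qed.

Lemma oddsK x y : odds (interleave x y) = y.
Proof. by apply/funext => i; rewrite /odds /interleave /= odd_double /= uphalf_double. Qed.

Lemma interleaveK z : interleave (evens z) (odds z) = z.
Proof.
apply/funext => i; rewrite /evens /odds /interleave.
by rewrite -{4}(odd_double_half i); case: (odd i).
Qed.

Lemma evens_linear (a : A^c) x y : evens (a *: x + y) = a *: evens x + evens y.
Proof. by []. Qed.

Lemma odds_linear (a : A^c) x y : odds (a *: x + y) = a *: odds x + odds y.
Proof. by []. Qed.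

Lemma interleave_linear (a : A^c) x y x' y' :
  interleave (a *: x + x') (a *: y + y') = a *: interleave x y + interleave x' y'.
Proof.
by apply/funext => i; rewrite /interleave !(sequDE, sequZE); case: (odd i).
Qed.

Lemma bip_double m n z : bip m.*2 n.*2 z z =
  bip m n (evens z) (evens z) + bip m n (odds z) (odds z).
Proof.
have [mn|nm] := leqP m n; last first.
  by rewrite /bip !big_geq ?leq_double ?(ltnW nm)// addr0.
elim: n mn => [|n IH].
  by rewrite leqn0 => /eqP->; rewrite /bip !big_geq// addr0.
rewrite leq_eqVlt => /orP[/eqP->|]; first by rewrite /bip !big_geq// addr0.
rewrite ltnS => mn; rewrite doubleS /bip big_nat_recr/=; last first.
  by rewrite leqW// leq_double.
rewrite big_nat_recr ?leq_double//= (big_nat_recr n)//= (big_nat_recr n)//=.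
by rewrite -[\sum_(m.*2 <= i < n.*2) _]/(bip _ _ z z) IH// [RHS]addrACA !addrA.
Qed.

Lemma bnrm_evens m n z : bnrm m n (evens z) <= bnrm m.*2 n.*2 z.
Proof. by rewrite ler_wsqrtr// bip_double pos_nrm_le//; exact: bip_pos. Qed.

Lemma bnrm_odds m n z : bnrm m n (odds z) <= bnrm m.*2 n.*2 z.
Proof. by rewrite ler_wsqrtr// bip_double addrC pos_nrm_le//; exact: bip_pos. Qed.

Lemma ell2_evens z : ell2 z -> ell2 (evens z).
Proof.
move=> /ell2P zP; apply/ell2P => e /zP[N NP]; exists N => m n Nm mn.
apply: le_lt_trans (bnrm_evens _ _ _) _; apply: NP; last by rewrite leq_double.
by rewrite -addnn (leq_trans Nm)// leq_addr.
Qed.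

Lemma ell2_odds z : ell2 z -> ell2 (odds z).
Proof.
move=> /ell2P zP; apply/ell2P => e /zP[N NP]; exists N => m n Nm mn.
apply: le_lt_trans (bnrm_odds _ _ _) _; apply: NP; last by rewrite leq_double.
by rewrite -addnn (leq_trans Nm)// leq_addr.
Qed.

Lemma hn_evens z : ell2 z -> hn (evens z) <= hn z.
Proof.
move=> zl; apply: hn_le (ell2_evens zl) _ => n.
by apply: le_trans (bnrm_evens _ _ _) _; exact: bnrm_hn.
Qed.

Lemma hn_odds z : ell2 z -> hn (odds z) <= hn z.
Proof.
move=> zl; apply: hn_le (ell2_odds zl) _ => n.
by apply: le_trans (bnrm_odds _ _ _) _; exact: bnrm_hn.
Qed.

(** The block is enlarged to even end points, where it splits exactly; the upper end is rounded up,
    whence [n.+1./2]. *)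
Lemma bnrm_interleave m n x y : (m <= n)%N ->
  bnrm m n (interleave x y) <= bnrm m./2 n.+1./2 x + bnrm m./2 n.+1./2 y.
Proof.
move=> mn; set z := interleave x y.
have h : bnrm m n z <= bnrm m./2.*2 n.+1./2.*2 z.
  apply: bnrm_le => //; first by rewrite -{2}(odd_double_half m) leq_addl.
  by rewrite -ltnS -[leqLHS](odd_double_half n.+1) -[leqRHS]add1n leq_add2r; case: odd.
apply: le_trans h _; apply: le_of_sqr; first by rewrite addr_ge0 ?bnrm_ge0.
rewrite bnrm_sqr bip_double evensK oddsK; apply: le_trans (nrmD _ _) _.
rewrite -!bnrm_sqr sqrrD addrAC lerDl mulrn_wge0//.
by rewrite mulr_ge0 ?bnrm_ge0.
Qed.

Lemma ell2_interleave x y : ell2 x -> ell2 y -> ell2 (interleave x y).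
Proof.
move=> /ell2P xP /ell2P yP; apply/ell2P => e e0.
have e2 : 0 < e / 2 by rewrite divr_gt0.
have [[N NP] [M MP]] := (xP _ e2, yP _ e2).
exists (maxn N M).*2 => m n NMm mn.
have : (maxn N M <= m./2)%N by rewrite -(doubleK (maxn N M)) half_leq.
rewrite geq_max => /andP[Nm Mm].
have mn2 : (m./2 <= n.+1./2)%N by rewrite half_leq// leqW.
have := NP _ _ Nm mn2; have := MP _ _ Mm mn2; have := bnrm_interleave x y mn; lra.
Qed.

Lemma hn_interleave0 x : ell2 x -> hn (interleave x 0) <= hn x.
Proof.
move=> xl; apply: hn_le => [|n]; first by apply: ell2_interleave => //; exact: ell2_0.
apply: le_trans (bnrm_interleave _ _ (leq0n n)) _.
have -> : bnrm 0./2 n.+1./2 (0 : sequ A) = 0.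
  by apply/eqP; rewrite eq_le bnrm_ge0 andbT -(hn0 A) bnrm_hn//; exact: ell2_0.
by rewrite addr0 bnrm_hn.
Qed.

Section Submodule.
Variables C D : closed_submodule A.

Let S : set (sequ A) := [set z | cs_set C (evens z) /\ cs_set D (odds z)].

Let S_ell2 : S `<=` @ell2 R A.
Proof.
move=> z [zC zD]; rewrite -(interleaveK z).
by apply: ell2_interleave; [exact: cs_sub zC|exact: cs_sub zD].
Qed.

Let S_zero : S 0.
Proof. by split; exact: cs_zero. Qed.

Let S_linear (a : A^c) x y : S x -> S y -> S (a *: x + y).
Proof. by move=> [xC xD] [yC yD]; split; [exact: cs_lin|exact: cs_lin]. Qed.

Let S_closed z : ell2 z ->
  (forall e : R, 0 < e -> exists2 y, S y & hn (z - y) < e) -> S z.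
Proof.
move=> zl zS; split; apply: cs_limit.
- exact: ell2_evens.
- move=> e /zS[y yS zy]; exists (evens y); first by have [] := yS.
  by apply: le_lt_trans zy; apply: (@hn_evens (z - y)); apply/ell2B/S_ell2.
- exact: ell2_odds.
- move=> e /zS[y yS zy]; exists (odds y); first by have [] := yS.
  by apply: le_lt_trans zy; apply: (@hn_odds (z - y)); apply/ell2B/S_ell2.
Qed.

Definition cs_interleave : closed_submodule A :=
  mk_closed S_ell2 S_zero S_linear S_closed.

Lemma cs_interleave_iso :
  lmod_iso (cs_type cs_interleave) (dsum (cs_type C) (cs_type D)).
Proof.
have evC z : cs_set cs_interleave z -> cs_set C (evens z) by case.
have odD z : cs_set cs_interleave z -> cs_set D (odds z) by case.
have [f fE] := @cs_map _ _ cs_interleave C evens evC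
  (fun a x y _ _ => evens_linear a x y).
have [g gE] := @cs_map _ _ cs_interleave D odds odD
  (fun a x y _ _ => odds_linear a x y).
pose fg (z : cs_type cs_interleave) : dsum (cs_type C) (cs_type D) := (f z, g z).
apply: (@lmod_iso_bij _ _ _ fg).
- by move=> a x y; rewrite /fg !linearP.
- move=> x y [/(congr1 (@cs_val _ _ _)) + /(congr1 (@cs_val _ _ _))].
  rewrite !fE !gE => ev od; apply: cs_val_inj.
  by rewrite -(interleaveK x) ev od interleaveK.
- move=> [x y].
  have zS : cs_set cs_interleave (interleave x y).
    by split; rewrite ?evensK ?oddsK; exact: cs_eltP.
  exists (cs_elt zS); congr (_, _); apply: cs_val_inj;
    by rewrite ?fE ?gE /= ?evensK ?oddsK.
Qed.

End Submodule.

End Interleaving.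

(** * Complements in finitely generated submodules and transfer of [prec] *)

Section Prec.
Variables (R : realType) (A : unitalCstarType R).
Implicit Types (B C D P Q : closed_submodule A).

Lemma fin_generated_surj (T : pzRingType) (M N : lmodType T) (f : {linear M -> N}) :
  (forall y, exists x, f x = y) -> fin_generated M -> fin_generated N.
Proof.
move=> fs [n [g gM]]; exists n, (f \o g) => y.
have [x <-] := fs y; have [a ->] := gM x; exists a.
by rewrite linear_sum; apply: eq_bigr => i _; rewrite linearZ.
Qed.

Lemma fin_generated_iso (T : pzRingType) (M N : lmodType T) :
  lmod_iso M N -> fin_generated M -> fin_generated N.
Proof.
by move=> [f [g fK gK]]; apply: (fin_generated_surj (f := f)) => y; exists (g y).
Qed.

(** [Q] is the kernel on [B] of the retraction onto [P]: closed because the retraction is bounded,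
    and finitely generated as the image of [B] under [x |-> x - r x], which stays in [B] since [P]
    does. *)
Lemma fg_complement B P : cs_fg B -> cs_fg P -> cs_set P `<=` cs_set B ->
  exists Q, cs_fg Q /\ lmod_iso (cs_type B) (dsum (cs_type P) (cs_type Q)).
Proof.
move=> fB fP PB; have [r [rP rK rl [K rb]]] := fg_retraction fP.
have Bl x : cs_set B x -> cs_set (cs_full A) x by exact: cs_sub.
pose S : set (sequ A) := [set x | cs_set B x /\ r x = 0].
have S_ell2 : S `<=` @ell2 R A by move=> x [/cs_sub].
have S_zero : S 0 by split; [exact: cs_zero|exact: linear_on0 rl].
have S_lin (a : A^c) x y : S x -> S y -> S (a *: x + y).
  move=> [xB x0] [yB y0]; split; first exact: cs_lin.
  by rewrite rl ?x0 ?y0 ?scaler0 ?addr0//; exact: Bl.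
have S_closed x : ell2 x ->
    (forall e : R, 0 < e -> exists2 y, S y & hn (x - y) < e) -> S x.
  move=> xl xS; split.
    by apply: cs_limit => // e /xS[y [yB _] xy]; exists y.
  apply: hn_eq0; first exact: cs_sub (rP _ xl).
  apply/eqP; rewrite eq_le hn_ge0 andbT; apply/ler_addgt0Pl => e e0; rewrite addr0.
  have K1 : 0 < `|K| + 1 by rewrite ltr_wpDl.
  have [y yS] := xS _ (divr_gt0 e0 K1); have yl := S_ell2 _ yS; have [yB y0] := yS.
  rewrite ltr_pdivlMr// => /ltW xy; apply: le_trans xy.
  have -> : r x = r (x - y) by rewrite (linear_onB rl)// y0 subr0.
  apply: le_trans (rb _ (ell2B xl yl)) _.
  by rewrite mulrC ler_wpM2l ?hn_ge0// (le_trans (ler_norm _))// lerDl.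
pose Q := mk_closed S_ell2 S_zero S_lin S_closed.
have rBP x : cs_set B x -> cs_set P (r x) by move=> xB; apply: rP; exact: cs_sub xB.
have lB : linear_on B r by move=> a x y xB yB; apply: rl; exact: Bl.
have sQ x : cs_set B x -> cs_set Q (x - r x).
  move=> xB; split; first by apply: csB => //; apply: PB; exact: rBP.
  rewrite (linear_onB rl) ?[r (r x)]rK ?subrr//; first exact: rBP.
    exact: Bl.
  exact: cs_sub (rBP _ xB).
have ls : linear_on B (fun x => x - r x).
  by move=> a x y xB yB /=; rewrite lB// scalerBr opprD addrACA.
have [f fE] := cs_map rBP lB; have [g gE] := cs_map sQ ls.
exists Q; split.
  apply: (fin_generated_surj (f := g)) fB => y; have [yB y0] := cs_eltP y.
  by exists (cs_elt yB); apply: cs_val_inj; rewrite gE /= y0 subr0.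
pose fg (z : cs_type B) : dsum (cs_type P) (cs_type Q) := (f z, g z).
apply: (@lmod_iso_bij _ _ _ fg).
- by move=> a x y; rewrite /fg !linearP.
- move=> x y [/(congr1 (@cs_val _ _ _)) + /(congr1 (@cs_val _ _ _))].
  rewrite !fE !gE => -> /addIr; exact: cs_val_inj.
- move=> [y z]; have yP := cs_eltP y; have [zB z0] := cs_eltP z.
  have yB := PB _ yP.
  have ryz : r ((y : sequ A) + (z : sequ A)) = y.
    by rewrite (linear_onD rl) ?z0 ?addr0 ?rK//; exact: Bl.
  exists (cs_elt (csD yB zB)); congr (_, _); apply: cs_val_inj.
    by rewrite fE /= ryz.
  by rewrite gE /= ryz addrAC subrr add0r.
Qed.

(* If [Q] is a complement in [B] of the copy of [N], then [D] and [dsum C Q]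
   have the same class in [K_0]; interleaving realizes [dsum C Q] in [H_A]. *)
Lemma prec_transfer (hK : K0_cancellation A) N B C D :
  cs_fg N -> cs_fg B -> cs_fg C -> cs_fg D ->
  lmod_iso (dsum (cs_type N) (cs_type D)) (dsum (cs_type B) (cs_type C)) ->
  prec N B -> prec C D.
Proof.
move=> fN fB fC fD ND [P PB NP]; have nP := hiso_lmod_iso NP.
have fP : cs_fg P := fin_generated_iso nP fN.
have [Q [fQ BPQ]] := fg_complement fB fP PB.
pose Z := cs_interleave C Q; have ZCQ : lmod_iso _ _ := cs_interleave_iso C Q.
have fZ : cs_fg Z := fin_generated_iso (lmod_iso_sym ZCQ) (fin_generated_prod fC fQ).
pose pN := FGProj fN (fg_projective fN).
(* Cancellation upgrades an equality of classes to an isomorphism that is bounded in both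
   directions. *)
have ZD : hiso Z D.
  apply: (hK _ _ fD fZ (fg_projective fD) (fg_projective fZ)).
  (* [N] is the stabilizing summand: [Z + N], that is [C + Q + N], is [C + B] because [N] is a copy
     of [P], and [B + C] is [N + D]. *)
  apply/K0_classE; exists pN.
  have swap (U V : lmodType A^c) : lmod_iso (dsum U V) (dsum V U).
    apply: (@lmod_isoI _ (dsum U V) (dsum V U)
      (fun x => (x.2, x.1)) (fun x => (x.2, x.1))) => //.
      by case.
    by case.
  have shuffle (U V W : lmodType A^c) :
      lmod_iso (dsum (dsum U V) W) (dsum (dsum W V) U).
    apply: (@lmod_isoI _ (dsum (dsum U V) W) (dsum (dsum W V) U)
      (fun x => (x.2, x.1.2, x.1.1)) (fun x => (x.2, x.1.2, x.1.1))) => //.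
      by case=> [[]].
    by case=> [[]].
  apply: lmod_iso_trans (lmod_iso_prod ZCQ (lmod_iso_refl _)) _.
  apply: lmod_iso_trans (shuffle _ _ _) _.
  apply: lmod_iso_trans (swap _ _); apply: lmod_iso_sym.
  apply: lmod_iso_trans ND _; apply: lmod_iso_prod (lmod_iso_refl _).
  apply: lmod_iso_trans BPQ _; apply: lmod_iso_prod (lmod_iso_refl _).
  exact: lmod_iso_sym.
have [f [g [[fZD gDZ] [fl gl] fK gK [[K fb] [L gb]]]]] := hiso_elim ZD.
(* The image of [C] in [D], described through the inverse [g] so that its closedness follows from
   the boundedness of [g]. *)
pose S : set (sequ A) := [set y | cs_set D y /\ odds (g y) = 0].
have S_ell2 : S `<=` @ell2 R A by move=> x [/cs_sub].
have S_zero : S 0 by split; [exact: cs_zero|rewrite (linear_on0 gl)].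
have S_lin (a : A^c) x y : S x -> S y -> S (a *: x + y).
  move=> [xD x0] [yD y0]; split; first exact: cs_lin.
  by rewrite gl// odds_linear x0 y0 scaler0 addr0.
have S_closed x : ell2 x ->
    (forall e : R, 0 < e -> exists2 y, S y & hn (x - y) < e) -> S x.
  move=> xl xS.
  have xD : cs_set D x.
    by apply: cs_limit => // e /xS[y [yD _] xy]; exists y.
  split=> //; have gl2 := cs_sub (gDZ _ xD).
  apply: hn_eq0; first exact: ell2_odds.
  apply/eqP; rewrite eq_le hn_ge0 andbT; apply/ler_addgt0Pl => e e0; rewrite addr0.
  have L1 : 0 < `|L| + 1 by rewrite ltr_wpDl.
  have [y [yD y0]] := xS _ (divr_gt0 e0 L1).
  rewrite ltr_pdivlMr// => /ltW xy; apply: le_trans xy.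
  have xyD := csB xD yD.
  have -> : odds (g x) = odds (g (x - y)).
    by rewrite (linear_onB gl)// -[RHS]/(odds (g x) - odds (g y)) y0 subr0.
  apply: le_trans (hn_odds (cs_sub (gDZ _ xyD))) _.
  apply: le_trans (gb _ xyD) _.
  by rewrite mulrC ler_wpM2l ?hn_ge0// (le_trans (ler_norm _))// lerDl.
pose W := mk_closed S_ell2 S_zero S_lin S_closed.
have CZ x : cs_set C x -> cs_set Z (interleave x 0).
  by move=> xC; split; rewrite ?evensK ?oddsK//; exact: cs_zero.
exists W; first by move=> x [].
apply: (@hiso_intro _ _ C W (fun x => f (interleave x 0)) (fun y => evens (g y))).
- move=> x xC; have xZ := CZ _ xC; split; first exact: fZD.
  by rewrite fK// oddsK.
- by move=> y [yD _]; have [] := gDZ _ yD.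
- move=> a x y xC yC; rewrite -fl; [|exact: CZ..].
  by rewrite -interleave_linear scaler0 addr0.
- by move=> a x y [xD _] [yD _]; rewrite gl.
- by move=> x xC; rewrite fK ?evensK//; exact: CZ.
- by move=> y [yD y0]; rewrite -y0 interleaveK gK.
- exists `|K| => x xC; have xl := cs_sub xC.
  apply: le_trans (fb _ (CZ _ xC)) _.
  apply: le_trans (ler_wpM2r (hn_ge0 _) (ler_norm _)) _.
  by rewrite ler_wpM2l// hn_interleave0.
- exists L => y [yD _]; apply: le_trans (gb _ yD).
  exact: hn_evens (cs_sub (gDZ _ yD)).
Qed.

End Prec.

Theorem lemma5p2 (R : realType) (A : unitalCstarType R)
    (hK : K0_cancellation A) (F : sequ A -> sequ A) :
  (MPhi_plus_minus F ->
     forall M1 N1 M2 N2 : closed_submodule A,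
       fredholm_decomposition F M1 N1 M2 N2 -> prec N1 N2) /\
  (MPhi_minus_plus F ->
     forall M1 N1 M2 N2 : closed_submodule A,
       fredholm_decomposition F M1 N1 M2 N2 -> prec N2 N1).
Proof.
split=> -[FA [M1' [N1' [M2' [N2' [D' N']]]]]] M1 N1 M2 N2 D;
  have [_ _ _ [f1' f2']] := D'; have [_ _ _ [f1 f2]] := D.
  exact: (prec_transfer hK f1' f2' f1 f2 (fredholm_index FA D' D)).
(* Exchanging domain and target modules calls for the index isomorphism in the opposite
   direction. *)
apply: (prec_transfer hK f2' f1' f2 f1 _ N').
exact/lmod_iso_sym/(fredholm_index FA D' D).
Qed.
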